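(* Let $q$ be a power of a prime number and $A=\mathbb{F}_q[X,X^{-1}]$. Let $\mathrm{SL}_2(A)$ be endowed with the length function $L(\gamma)=d_0(v_0,\gamma v_0)+d_\infty(v_\infty,\gamma v_\infty)$ coming from its diagonal action on the product $T_0\times T_\infty$ of the Bruhat-Tits trees of $\mathrm{SL}_2(\mathbb{K}_0)$ and $\mathrm{SL}_2(\mathbb{K}_\infty)$, where $(v_0,v_\infty)$ is a pair of vertices of $T_0$ and $T_\infty$. Then $\mathrm{SL}_2(A)$ has the radial rapid decay property (RRD) with respect to $L$.
   Context: $\mathbb{K}=\mathbb{F}_q(X)$. $v_0$-valuation: for $F=X^nP/Q$ with $P,Q\in\mathbb{F}_q[X]$ not divisible by $X$, the valuation at $0$ of $F$ is $n$. The valuation at infinity of $P/Q$ is $\deg Q-\deg P$. $\mathbb{K}_0$ and $\mathbb{K}_\infty$ denote the completions of $\mathbb{K}$ for the corresponding absolute values $q^{-\mathrm{val}(\cdot)}$ (so $\mathbb{K}_0\cong\mathbb{F}_q((X))$, $\mathbb{K}_\infty\cong\mathbb{F}_q((X^{-1}))$). The group $\mathrm{SL}_2(A)$ embeds diagonally in $\mathrm{SL}_2(\mathbb{K}_0)\times\mathrm{SL}_2(\mathbb{K}_\infty)$. For $i\in\{0,\infty\}$, $T_i$ is the Bruhat-Tits tree of $\mathrm{SL}_2(\mathbb{K}_i)$: with $\mathcal{O}_i$ the valuation ring of $\mathbb{K}_i$, vertices are homothety classes of $\mathcal{O}_i$-lattices in $\mathbb{K}_i^2$, two classes being adjacent if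 they have representatives $\Lambda'\subset\Lambda$ with $\Lambda/\Lambda'$ isomorphic to the residue field. It is a $(q+1)$-regular tree on which $\mathrm{SL}_2(\mathbb{K}_i)$ acts; $d_i$ is the distance giving length $1$ to edges. Radial rapid decay: for a discrete group $\Gamma$ with a proper length function $L$ (finite balls), $\mathbb{C}[\Gamma]$ is the space of finitely supported functions; $f\in\mathbb{C}[\Gamma]$ is radial if $L(g_1)=L(g_2)$ implies $f(g_1)=f(g_2)$; for $f\neq0$, $L(f)=\max\{L(g):g\in\operatorname{supp}f\}$; $\Vert f\Vert_{op}$ is the norm of $\xi\mapsto f*\xi$ on $\ell^2(\Gamma)$, with $(f*\xi)(g)=\sum_hf(h)\xi(h^{-1}g)$. $\Gamma$ has RRD with respect to $L$ if there is $P\in\mathbb{R}[X]$ such that $\Vert f\Vert_{op}\le P(L(f))\Vert f\Vert_2$ for every nonzero radial $f\in\mathbb{C}[\Gamma]$. *)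

(* Defs.v *)
From HB Require Import structures.
From mathcomp Require Import all_boot all_order all_algebra fraction.
From mathcomp Require Import all_classical all_reals ereal esum.
From mathcomp Require Import complex.

Set Implicit Arguments.
Unset Strict Implicit.
Unset Printing Implicit Defensive.

Import Order.TTheory GRing.Theory Num.Theory.

Local Open Scope classical_set_scope.
Local Open Scope ring_scope.

Section RadialRapidDecay.
Variables (R : realType) (G : groupType).

Record proper_length (L : G -> R) : Prop := ProperLength {
  length1 : L 1%g = 0;
  lengthV : forall g : G, L g^-1%g = L g;
  lengthM : forall g h : G, L (g * h)%g <= L g + L h;
  finite_balls : forall r : R, finite_set [set g | L g <= r]
}.

Definition supp (f : G -> R[i]) : set G := [set g | f g <> 0].

Definition radial (L : G -> R) (f : G -> R[i]) : Prop :=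
  forall g1 g2 : G, L g1 = L g2 -> f g1 = f g2.

(* The maximum of [L] over the finite set [supp f]; the default [0] is
   harmless because a length function is nonnegative. *)
Definition fun_length (L : G -> R) (f : G -> R[i]) : R :=
  \big[Num.max/0]_(g \in supp f) L g.

Definition l2norm (xi : G -> R[i]) : \bar R :=
  sqrte (\esum_(g in [set: G]) ((ComplexField.Normc.normc (xi g)) ^+ 2)%:E).

(* A finite sum whenever [f] is finitely supported. *)
Definition conv (f xi : G -> R[i]) : G -> R[i] :=
  fun g => \sum_(h \in [set: G]) (f h * xi (h^-1 * g)%g).

Definition opnorm (f : G -> R[i]) : \bar R :=
  ereal_sup [set l2norm (conv f xi) | xi in [set xi | (l2norm xi <= 1)%E]].

(* Properness of the length function is part of the property. *)
Definition RRD (L : G -> R) : Prop :=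
  proper_length L /\
  exists P : {poly R}, forall f : G -> R[i],
    finite_set (supp f) -> supp f !=set0 -> radial L f ->
    (opnorm f <= (P.[fun_length L f])%:E * l2norm f)%E.

End RadialRapidDecay.

Section SpecialLinearGroup.
Variables (n : nat) (A : comNzRingType).

Record SL := MkSL { SL_mx :> 'M[A]_n; _ : \det SL_mx == 1 }.

HB.instance Definition _ := [isSub for SL_mx].
HB.instance Definition _ := [Choice of SL by <:].

Lemma det_SL (g : SL) : \det g = 1.
Proof. by apply/eqP; case: g. Qed.

Fact SL_one_subproof : \det (1%:M : 'M[A]_n) == 1.
Proof. by rewrite det1. Qed.

Fact SL_mul_subproof (g h : SL) : \det (SL_mx g *m SL_mx h) == 1.
Proof. by rewrite det_mulmx !det_SL mulr1. Qed.

Fact SL_inv_subproof (g : SL) : \det (\adj (SL_mx g)) == 1.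
Proof.
have := congr1 (fun M : 'M[A]_n => \det M) (mul_mx_adj (SL_mx g)).
by rewrite det_mulmx det_SL mul1r det1 => ->.
Qed.

Definition SL_one : SL := MkSL SL_one_subproof.
Definition SL_mul (g h : SL) : SL := MkSL (SL_mul_subproof g h).
Definition SL_inv (g : SL) : SL := MkSL (SL_inv_subproof g).

Fact SL_mulA : associative SL_mul.
Proof. by move=> x y z; apply/val_inj; rewrite /= mulmxA. Qed.

Fact SL_mul1 : left_id SL_one SL_mul.
Proof. by move=> x; apply/val_inj; rewrite /= mul1mx. Qed.

Fact SL_mulr1 : right_id SL_one SL_mul.
Proof. by move=> x; apply/val_inj; rewrite /= mulmx1. Qed.

Fact SL_mulV : left_inverse SL_one SL_inv SL_mul.
Proof. by move=> x; apply/val_inj; rewrite /= mul_adj_mx det_SL. Qed.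

Fact SL_mulVr : right_inverse SL_one SL_inv SL_mul.
Proof. by move=> x; apply/val_inj; rewrite /= mul_mx_adj det_SL. Qed.

HB.instance Definition _ :=
  isGroup.Build SL SL_mulA SL_mul1 SL_mulr1 SL_mulV SL_mulVr.

End SpecialLinearGroup.

Fact SL_map_subproof (n : nat) (A B : comNzRingType) (f : {rmorphism A -> B})
  (g : SL n A) : \det (map_mx f g) == 1.
Proof. by rewrite det_map_mx det_SL rmorph1. Qed.

Definition SL_map (n : nat) (A B : comNzRingType) (f : {rmorphism A -> B})
  (g : SL n A) : SL n B := MkSL (SL_map_subproof f g).

Section LaurentPolynomials.
Variable F : fieldType.

Local Notation K := {fraction {poly F}}.
Local Notation "x %:F" := (tofrac x).

Definition laurent_pred : {pred K} :=
  fun f => `[< exists (P : {poly F}) (n : nat), f = P%:F / ('X%:F) ^+ n >].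

Fact tofracX_neq0 : ('X : {poly F})%:F != 0.
Proof. by rewrite tofrac_eq0 polyX_eq0. Qed.

Fact laurent_subring_closed : subring_closed laurent_pred.
Proof.
have X0 n : ('X : {poly F})%:F ^+ n != 0 by rewrite expf_neq0 ?tofracX_neq0.
split=> [|f g /asboolP[P [m ->]] /asboolP[Q [n ->]]
        |f g /asboolP[P [m ->]] /asboolP[Q [n ->]]]; apply/asboolP.
- by exists 1, 0%N; rewrite expr0 divr1 tofrac1.
- exists (P * 'X ^+ n - Q * 'X ^+ m), (m + n)%N.
  by rewrite -mulNr addf_div // rmorphB !rmorphM !rmorphXn /= exprD mulNr.
- exists (P * Q), (m + n)%N.
  by rewrite mulf_div rmorphM /= exprD.
Qed.

HB.instance Definition _ :=
  GRing.isSubringClosed.Build K laurent_pred laurent_subring_closed.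

(* The ring F[X, X^-1], as a subring of F(X). *)
Record laurent := MkLaurent { laurent_val :> K; _ : laurent_val \in laurent_pred }.

HB.instance Definition _ := [isSub for laurent_val].
HB.instance Definition _ := [Choice of laurent by <:].
HB.instance Definition _ := [SubChoice_isSubComNzRing of laurent by <:].

End LaurentPolynomials.

Section Valuations.
Variables (R : realType) (F : finFieldType).

Local Notation K := {fraction {poly F}}.
Local Notation "x %:F" := (tofrac x).

(* Both valuations are those of the nonzero elements of F(X); the integer
   picked by [xget] does not depend on the chosen fraction. *)
Definition val_zero (f : K) : int :=
  xget 0 [set n : int | exists P Q : {poly F},
    [/\ ~~ ('X %| P), ~~ ('X %| Q) & f = 'X%:F ^ n * (P%:F / Q%:F)]].

(* [size P = deg P + 1] for [P != 0]. *)
Definition val_infty (f : K) : int :=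
  xget 0 [set n : int | exists P Q : {poly F},
    [/\ P != 0, Q != 0, f = P%:F / Q%:F & n = (size Q)%:Z - (size P)%:Z]].

Definition abs_zero (f : K) : R :=
  if f == 0 then 0 else (#|F|%:R : R) ^ (- val_zero f).

Definition abs_infty (f : K) : R :=
  if f == 0 then 0 else (#|F|%:R : R) ^ (- val_infty f).

End Valuations.

Record absolute_value (R : realType) (K : fieldType) (a : K -> R) : Prop :=
  AbsoluteValue {
    av_ge0 : forall x, 0 <= a x;
    av_eq0 : forall x, a x = 0 <-> x = 0;
    avM : forall x y, a (x * y) = a x * a y;
    avD : forall x y, a (x + y) <= a x + a y
  }.

(* A completion of the field [K] for [a]: a complete valued field in which [K]
   embeds isometrically with dense image; it is unique up to a unique isometric
   isomorphism over [K]. *)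
Record completion (R : realType) (K : fieldType) (a : K -> R) := Completion {
  compl_field :> fieldType;
  compl_abs : compl_field -> R;
  compl_emb : {rmorphism K -> compl_field};
  compl_absP : absolute_value compl_abs;
  compl_abs_emb : forall x : K, compl_abs (compl_emb x) = a x;
  compl_dense : forall (x : compl_field) (e : R), 0 < e ->
    exists y : K, compl_abs (x - compl_emb y) < e;
  compl_complete : forall u : nat -> compl_field,
    (forall e : R, 0 < e -> exists N : nat, forall m n : nat,
       (N <= m)%N -> (N <= n)%N -> compl_abs (u m - u n) < e) ->
    exists l : compl_field, forall e : R, 0 < e ->
      exists N : nat, forall n : nat, (N <= n)%N -> compl_abs (u n - l) < e
}.

(* The [O]-modules [M / M'] and [N / N'] are isomorphic: [phi] sends an element
   of [M] to a representative of the image of its class. *)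
Definition subquotient_iso (K : fieldType) (O : set K) (V W : lmodType K)
    (M M' : set V) (N N' : set W) : Prop :=
  exists phi : V -> W,
    [/\ forall x, M x -> N (phi x),
        forall x y, M x -> M y -> N' (phi (x + y) - (phi x + phi y)),
        forall a x, O a -> M x -> N' (phi (a *: x) - a *: phi x),
        forall x, M x -> (N' (phi x) <-> M' x) &
        forall y, N y -> exists2 x, M x & N' (y - phi x)].

Section BruhatTitsTree.
Variables (R : realType) (K : fieldType) (a : K -> R).

Local Notation V := 'cV[K]_2.

Definition val_ring : set K := [set x | a x <= 1].
Definition val_max_ideal : set K := [set x | a x < 1].

(* Finitely generated [val_ring]-submodules of K^2 spanning K^2 over [K]; the
   generators are the columns of [B]. *)
Definition is_lattice (L : set V) : Prop :=
  exists (m : nat) (B : 'M[K]_(2, m)),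
    \rank B = 2%N /\
    L = [set B *m c | c in [set c : 'cV[K]_m | forall i, val_ring (c i 0)]].

Definition homothety_class (L : set V) : set (set V) :=
  [set L' | exists2 c : K, c != 0 & L' = [set c *: x | x in L]].

Definition is_vertex (v : set (set V)) : Prop :=
  exists2 L : set V, is_lattice L & v = homothety_class L.

Record vertex := MkVertex {
  vertex_set :> set (set V);
  vertexP : is_vertex vertex_set
}.

Definition adjacent (v w : vertex) : Prop :=
  exists L L' : set V,
    [/\ vertex_set v L, vertex_set w L', L' `<=` L &
        subquotient_iso val_ring L L'
          (val_ring : set K^o) (val_max_ideal : set K^o)].

Fixpoint walk (n : nat) (v w : vertex) : Prop :=
  if n is m.+1 then exists2 u : vertex, adjacent v u & walk m u w else v = w.

(* The tree is connected, so the default value of [xget] is never used. *)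
Definition tree_dist (v w : vertex) : nat :=
  xget 0%N [set n | walk n v w /\ forall m, walk m v w -> (n <= m)%N].

Definition act_set (g : 'M[K]_2) (v : set (set V)) : set (set V) :=
  [set [set g *m x | x in L] | L in v].

Fact act_subproof (g : SL 2 K) (v : vertex) : is_vertex (act_set g v).
Proof.
case: (vertexP v) => _ [m [B [rkB ->]]] ->.
have ug : (g : 'M[K]_2) \in unitmx by rewrite unitmxE det_SL unitr1.
set L := [set B *m c | c in _]; exists [set (g : 'M[K]_2) *m x | x in L].
  exists m, (g *m B); split; first by rewrite (eqmxMfull B) ?row_full_unit.
  rewrite /L image_comp; apply: eq_imagel => c _ /=; exact: mulmxA.
have comm (c : K) : [set (g : 'M[K]_2) *m x | x in [set c *: x | x in L]] =
    [set c *: x | x in [set (g : 'M[K]_2) *m x | x in L]].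
  by rewrite 2!image_comp; apply: eq_imagel => x _ /=; exact: esym (scalemxAr _ _ _).
apply/seteqP; split=> [_ [_ [c c0 ->] <-]|_ [c c0 ->]].
  by exists c => //; exact: comm.
by exists [set c *: x | x in L]; [exists c | exact: comm].
Qed.

Definition act (g : SL 2 K) (v : vertex) : vertex :=
  MkVertex (act_subproof g v).

End BruhatTitsTree.


Section LengthFunction.
Variables (R : realType) (F : finFieldType).

Local Notation K := {fraction {poly F}}.

Definition SL_emb (a : K -> R) (Ka : completion a) (g : SL 2 (laurent F)) :
    SL 2 Ka :=
  SL_map (compl_emb Ka \o \val) g.

Definition tree (a : K -> R) (Ka : completion a) : Type :=
  vertex (@compl_abs R K a Ka).

Definition displacement (a : K -> R) (Ka : completion a) (v : tree Ka)
    (g : SL 2 (laurent F)) : nat :=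
  tree_dist v (act (SL_emb Ka g) v).

Definition tree_length (K0 : completion (@abs_zero R F))
    (Kinf : completion (@abs_infty R F)) (v0 : tree K0) (vinf : tree Kinf)
    (g : SL 2 (laurent F)) : R :=
  (displacement v0 g + displacement vinf g)%:R.

End LengthFunction.

(* Main.v *)
Require Import Defs.
From mathcomp Require Import all_boot all_order all_algebra finmap fraction.
From mathcomp Require Import all_classical all_reals ereal esum.
From mathcomp Require Import complex finfield ring lra zify.

(** Up to a polynomial factor in [n], convolution by the indicator of the sphere
    of radius [n] of the group has norm at most q^(n/2), and the sphere, when it
    is nonempty, has at least q^n elements.

    Upper bound. Fix an end of each tree, and let [rho] be the exponential of
    the corresponding horofunction. The weight [poisson], the square root of the
    product of the two [rho] along the orbit of [(v0, vinf)], is positive on the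
    group, and Schur's test with this weight bounds the norm of convolution by
    the indicator of the sphere of radius [n]. The test amounts to a sum over
    that sphere. In a tree, a vertex [w] at distance [l] from [v] is reached by
    climbing [j] steps towards the end and descending [l - j] steps; there are
    at most q^(l - j) such vertices, and sqrt (rho w / rho v) = q^(j - l/2), so
    that each of the [l + 1] values of [j] contributes at most q^(l/2). Since the
    stabilizer of [(v0, vinf)] is finite, the norm is at most a constant times
    (n + 1)^3 q^(n/2) ([sphere_sum]).

    Lower bound. Each nonempty sphere of radius [n] has at least a constant
    times q^n elements ([sphere_growth]). As every vertex of the tree at 0 is
    the image of the standard vertex by a matrix over F[X, 1/X]
    ([rational_vertex]), a conjugate of SL2(F[X]) fixes [v0]. A matrix of
    SL2(F[X]) is obtained from every coprime pair of polynomials, one of them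
    monic of degree [m] and the other of smaller degree, and a positive
    proportion of the q^(2m) pairs is coprime ([card_coprime_pairs]). Multiplying
    on both sides by fixed unipotent matrices with a large entry makes one
    coefficient dominate, which gives all these matrices the same displacement of
    [vinf], exactly 2 (m + s) for a constant [s].

    For radial [f], the number |f| on the sphere of radius [n] is at most the l2
    norm of [f] divided by the square root of the cardinality of the sphere, so
    the two bounds combine to a bound of the operator norm of [f] by its l2 norm
    times a polynomial in the length of [f] ([RRD_of_spheres]).

    The trees are handled through matrices. The class of the lattice spanned by
    the columns of [h] is at distance log_q of [mxdist h h'] from that of [h']
    ([tree_distP]). Triangular representatives [hnf t u] identify the vertices
    with the balls of centre [u] and radius [ab t], a geodesic between two balls
    passing through the smallest ball that contains both. *)

Set Implicit Arguments.
Unset Strict Implicit.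
Unset Printing Implicit Defensive.

Import Order.TTheory GRing.Theory Num.Theory.

Local Open Scope classical_set_scope.
Local Open Scope ring_scope.

(** * Ultrametricity in positive characteristic *)

Section PositiveCharacteristic.
Variables (R : realType) (K : fieldType) (ab : K -> R) (av : absolute_value ab).

Lemma av1 : ab 1 = 1.
Proof.
have n0 : ab 1 != 0 by apply/eqP => /(av_eq0 av)/eqP; rewrite oner_eq0.
by apply: (mulfI n0); rewrite -(avM av) !mulr1.
Qed.

Lemma avX x n : ab (x ^+ n) = ab x ^+ n.
Proof. by elim: n => [|n IH]; rewrite ?expr0 ?av1// !exprS (avM av) IH. Qed.

Lemma avN x : ab (- x) = ab x.
Proof.
apply/eqP; rewrite -(@eqrXn2 _ 2) ?(av_ge0 av)//.
by rewrite -!avX sqrrN.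
Qed.

Lemma bernoulli (r : R) n : 0 <= r -> 1 + n%:R * r <= (1 + r) ^+ n.
Proof.
move=> r0; elim: n => [|n IH]; first by rewrite mul0r addr0 expr0.
rewrite exprS; apply: le_trans (ler_wpM2l _ IH); last by rewrite addr_ge0.
have : 0 <= n%:R * r * r by rewrite !mulr_ge0.
by rewrite -natr1; nra.
Qed.

(** Iterating Frobenius, the p^k-th power of [ab (x + y)] is at most twice the
    p^k-th power of the larger of [ab x] and [ab y], for all k. *)
Lemma av_ultra p : p \in [pchar K] -> forall x y, ab (x + y) <= Num.max (ab x) (ab y).
Proof.
move=> pK x y; set m := Num.max _ _.
have m0 : 0 <= m by rewrite le_max (av_ge0 av).
rewrite leNgt; apply/negP => ms.
have [m0'|mn0] := eqVneq m 0.
  have x0 : x = 0.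
    by apply/(av_eq0 av)/eqP; rewrite eq_le (av_ge0 av) andbT -m0' le_max lexx.
  have y0 : y = 0.
    by apply/(av_eq0 av)/eqP; rewrite eq_le (av_ge0 av) andbT -m0' le_max lexx orbT.
  by move: ms; rewrite x0 y0 addr0 (proj2 (av_eq0 av 0))// m0' ltxx.
have mp : 0 < m by rewrite lt_def mn0.
set r := ab (x + y) / m - 1.
have r0 : 0 < r by rewrite subr_gt0 ltr_pdivlMr// mul1r.
have le2 k : (1 + r) ^+ (p ^ k) <= 2.
  rewrite /r addrC subrK expr_div_n ler_pdivrMr ?exprn_gt0//.
  rewrite -avX exprDn_pchar; last first.
    by rewrite (eq_pnat _ (pcharf_eq pK)) pnatX pnat_id ?(pcharf_prime pK).
  apply: le_trans (avD av _ _) _; rewrite !avX mulr2n mulrDl mul1r.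
  by rewrite lerD// lerXn2r ?nnegrE ?(av_ge0 av)// le_max lexx ?orbT.
have := archi_boundP (ltW (divr_gt0 (@ltr0n R 1) r0)).
set k := Num.bound _; rewrite ltr_pdivrMr// => hk.
have := le_trans (bernoulli (p ^ k) (ltW r0)) (le2 k).
have : (k%:R : R) <= (p ^ k)%N%:R.
  by rewrite ler_nat ltnW// ltn_expl// prime_gt1 ?(pcharf_prime pK).
nra.
Qed.

End PositiveCharacteristic.

(** * Places with finite residue field *)

(** The part of the structure of the completions at 0 and at infinity on which
    the tree depends: an ultrametric absolute value with value group q^Z, a
    uniformizer [pi], and representatives [iota] of the residue classes. *)
Record place (R : realType) (F : finFieldType) (K : fieldType) (ab : K -> R)
    (iota : F -> K) (pi : K) : Prop := Place {
  place_av : absolute_value ab;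
  place_ultra : forall x y, ab (x + y) <= Num.max (ab x) (ab y);
  place_val : forall x, x != 0 -> exists n : int, ab x = #|F|%:R ^ n;
  place_unif : ab pi = #|F|%:R^-1;
  place_res : forall x, ab x <= 1 -> exists c : F, ab (x - iota c) < 1
}.

Lemma ord2P (P : 'I_2 -> Prop) : P 0 -> P 1 -> forall i, P i.
Proof. by move=> P0 P1 i; have [->|->] : i = 0 \/ i = 1; [|by []|by []];
  case: i => [[|[|//]]] h; [left|right]; apply/val_inj. Qed.

Lemma det2 (A : comNzRingType) (M : 'M[A]_2) :
  \det M = M 0 0 * M 1 1 - M 0 1 * M 1 0.
Proof.
rewrite (expand_det_row _ 0) !big_ord_recl big_ord0 addr0 /cofactor !det_mx11 !mxE.
rewrite /= expr0 mul1r expr1 mulN1r mulrN.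
by congr (_ * M _ _ - M _ _ * M _ _); apply/val_inj.
Qed.

Lemma mulmx2E (A : pzSemiRingType) m n (M : 'M[A]_(m, 2)) (N : 'M_(2, n)) i j :
  (M *m N) i j = M i 0 * N 0 j + M i 1 * N 1 j.
Proof.
rewrite mxE !big_ord_recl big_ord0 addr0.
by congr (_ + M _ _ * N _ _); apply/val_inj.
Qed.

Section Place.
Variables (R : realType) (F : finFieldType) (K : fieldType) (ab : K -> R).
Variables (iota : F -> K) (pi : K) (pl : place ab iota pi).

Local Notation q := (#|F|%:R : R).

Lemma q_gt1 : 1 < q.
Proof. by rewrite ltr1n card_finNzRing_gt1. Qed.

Lemma q_gt0 : 0 < q.
Proof. exact: lt_trans ltr01 q_gt1. Qed.

Lemma q_neq0 : q != 0. Proof. by rewrite gt_eqF ?q_gt0. Qed.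

Let av := place_av pl.

Lemma ab_ge0 x : 0 <= ab x. Proof. exact: av_ge0. Qed.

Lemma ab0 : ab 0 = 0. Proof. exact/(av_eq0 av). Qed.

Lemma ab_eq0 x : (ab x == 0) = (x == 0).
Proof. by apply/eqP/eqP => /(av_eq0 av). Qed.

Lemma ab_gt0 x : (0 < ab x) = (x != 0).
Proof. by rewrite lt_def ab_eq0 ab_ge0 andbT. Qed.

Lemma abM x y : ab (x * y) = ab x * ab y. Proof. exact: avM. Qed.

Lemma ab1 : ab 1 = 1. Proof. exact: av1. Qed.

Lemma abV x : ab x^-1 = (ab x)^-1.
Proof.
have [->|x0] := eqVneq x 0; first by rewrite invr0 ab0 invr0.
apply: (@mulfI _ (ab x)); first by rewrite ab_eq0.
by rewrite -abM !divff ?ab1 ?ab_eq0.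
Qed.

Lemma abX x n : ab (x ^+ n) = ab x ^+ n. Proof. exact: avX. Qed.

Lemma abN x : ab (- x) = ab x. Proof. exact: avN. Qed.

Lemma abB x y : ab (x - y) = ab (y - x).
Proof. by rewrite -abN opprB. Qed.

Lemma ab_add x y r : ab x <= r -> ab y <= r -> ab (x + y) <= r.
Proof. by move=> *; apply: le_trans (place_ultra pl x y) _; rewrite ge_max; apply/andP. Qed.

Lemma ab_sub x y r : ab x <= r -> ab y <= r -> ab (x - y) <= r.
Proof. by move=> *; apply: ab_add; rewrite ?abN. Qed.

Lemma ab_add_lt x y r : ab x < r -> ab y < r -> ab (x + y) < r.
Proof. by move=> *; apply: le_lt_trans (place_ultra pl x y) _; rewrite gt_max; apply/andP. Qed.

Lemma ab_sum (I : Type) (s : seq I) (P : pred I) (f : I -> K) r : 0 <= r ->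
  (forall i, P i -> ab (f i) <= r) -> ab (\sum_(i <- s | P i) f i) <= r.
Proof.
by move=> r0 h; elim/big_ind: _ => // [|x y]; rewrite ?ab0//; apply: ab_add.
Qed.

Lemma ab_dom x y : ab y < ab x -> ab (x + y) = ab x.
Proof.
move=> yx; apply/eqP; rewrite eq_le (ab_add (lexx _) (ltW yx)) /= leNgt.
by apply/negP => h; have := ab_add_lt (y := - y) h; rewrite abN addrK ltxx => /(_ yx).
Qed.

(** The value group is discrete, so a strict inequality improves by a factor q. *)
Lemma ab_lt x (n : int) : ab x < q ^ n -> ab x <= q ^ (n - 1).
Proof.
have [->|x0] := eqVneq x 0; first by rewrite ab0 exprz_ge0 // ltW ?q_gt0.
have [m ->] := place_val pl x0.
by rewrite ltr_eXz2l ?q_gt1// ler_eXz2l ?q_gt1//; lia.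
Qed.

Lemma abpi n : ab (pi ^+ n) = q ^- n.
Proof. by rewrite abX (place_unif pl) exprVn. Qed.

Lemma pi_neq0 : pi != 0.
Proof. by rewrite -ab_gt0 (place_unif pl) invr_gt0 q_gt0. Qed.

(** Expansion of an element of the valuation ring to precision [pi ^ N], obtained
    by repeatedly removing a residue and dividing by the uniformizer. *)
Lemma digits_exist N x : ab x <= 1 ->
  exists c : N.-tuple F, ab (x - \sum_(i < N) iota (tnth c i) * pi ^+ i) <= q ^- N.
Proof.
elim: N x => [|N IH] x x1.
  by exists [tuple]; rewrite big_ord0 subr0 expr0 invr1.
have [c0 hc0] := place_res pl x1.
have : ab ((x - iota c0) / pi) <= 1.
  rewrite abM abV (place_unif pl) invrK -ler_pdivlMr ?q_gt0// div1r.
  have := @ab_lt (x - iota c0) 0.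
  by rewrite expr0z sub0r exprN1; apply.
move=> /IH[c hc]; exists (cons_tuple c0 c).
rewrite big_ord_recl expr0 mulr1 tnth0.
under eq_bigr => i _ do rewrite tnthS /= exprS mulrCA.
rewrite -mulr_sumr opprD addrA.
have -> : x - iota c0 = pi * ((x - iota c0) / pi) by rewrite mulrC divfK ?pi_neq0.
by rewrite -mulrBr abM (place_unif pl) exprS invfM ler_pM2l ?invr_gt0 ?q_gt0.
Qed.

Definition digits N x : N.-tuple F :=
  xget (nseq_tuple N 0) [set c : N.-tuple F |
    ab (x - \sum_(i < N) iota (tnth c i) * pi ^+ i) <= q ^- N].

Lemma digitsP N x : ab x <= 1 ->
  ab (x - \sum_(i < N) iota (tnth (digits N x) i) * pi ^+ i) <= q ^- N.
Proof.
move=> /(digits_exist N) [c hc].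
by apply: (@xgetPex _ (nseq_tuple N 0) [set c : N.-tuple F |
  ab (x - \sum_(i < N) iota (tnth c i) * pi ^+ i) <= q ^- N]); exists c.
Qed.

Lemma digits_inj N x y : ab x <= 1 -> ab y <= 1 -> digits N x = digits N y ->
  ab (x - y) <= q ^- N.
Proof.
move=> /(digitsP N) hx /(digitsP N) hy e; rewrite -e in hy.
by have := ab_sub hx hy; rewrite opprB addrA subrK.
Qed.

(** * The operator norm on matrices *)

Definition nm m n (M : 'M[K]_(m, n)) : R :=
  \big[Num.max/0]_(p : 'I_m * 'I_n) ab (M p.1 p.2).

Lemma nm_ge0 m n (M : 'M_(m, n)) : 0 <= nm M.
Proof. exact: bigmax_ge_id. Qed.

Lemma nm_ge m n (M : 'M_(m, n)) i j : ab (M i j) <= nm M.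
Proof. exact: (le_bigmax _ (fun p => ab (M p.1 p.2)) (i, j)). Qed.

Lemma nm_le m n (M : 'M_(m, n)) r : 0 <= r ->
  (forall i j, ab (M i j) <= r) -> nm M <= r.
Proof. by move=> r0 h; apply: bigmax_le. Qed.

Lemma nm_attained m n (M : 'M_(m.+1, n.+1)) : exists i j, nm M = ab (M i j).
Proof.
have [|p _ e] := @eq_bigmax _ _ _ (0 : R) (ord0, ord0) (fun=> true)
   (fun p => ab (M p.1 p.2)) isT; first by move=> p _; exact: ab_ge0.
by exists p.1, p.2.
Qed.

Lemma nm_gt0 m n (M : 'M_(m, n)) : M != 0 -> 0 < nm M.
Proof.
apply: contra_neqT; rewrite -leNgt => h; apply/matrixP => i j; rewrite mxE.
by apply/eqP; rewrite -ab_eq0 eq_le ab_ge0 andbT (le_trans (nm_ge M i j)).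
Qed.

Lemma nmM m n p (M : 'M_(m, n)) (N : 'M_(n, p)) : nm (M *m N) <= nm M * nm N.
Proof.
apply: nm_le => [|i j]; first by rewrite mulr_ge0 ?nm_ge0.
rewrite mxE; apply: ab_sum => [|k _]; first by rewrite mulr_ge0 ?nm_ge0.
by rewrite abM ler_pM ?ab_ge0 ?nm_ge.
Qed.

Lemma nmM_le m n p (M : 'M_(m, n)) (N : 'M_(n, p)) r s :
  nm M <= r -> nm N <= s -> nm (M *m N) <= r * s.
Proof. by move=> hr hs; apply: le_trans (nmM _ _) (ler_pM _ _ hr hs); apply: nm_ge0. Qed.

Lemma nmZ m n a (M : 'M_(m, n)) : nm (a *: M) = ab a * nm M.
Proof.
have le b (N : 'M_(m, n)) : nm (b *: N) <= ab b * nm N.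
  apply: nm_le => [|i j]; first by rewrite mulr_ge0 ?ab_ge0 ?nm_ge0.
  by rewrite mxE abM ler_wpM2l ?ab_ge0 ?nm_ge.
apply/eqP; rewrite eq_le le/=; have [->|a0] := eqVneq a 0.
  by rewrite ab0 mul0r nm_ge0.
have := le a^-1 (a *: M); rewrite scalerA mulVf// scale1r abV.
by rewrite mulrC ler_pdivlMr ?ab_gt0// mulrC.
Qed.

Lemma nmD_le m n (M N : 'M_(m, n)) r : nm M <= r -> nm N <= r -> nm (M + N) <= r.
Proof.
move=> hM hN; apply: nm_le => [|i j]; first exact: le_trans (nm_ge0 M) hM.
by rewrite mxE ab_add// (le_trans (nm_ge _ i j)).
Qed.

(** Ultrametricity turns a dominant term into an exact norm. *)
Lemma nmD_dom (M N : 'M_2) : nm N < nm M -> nm (M + N) = nm M.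
Proof.
move=> h; apply/eqP; rewrite eq_le (nmD_le (lexx _) (ltW h)) /=.
have [i [j e]] := nm_attained M.
apply: le_trans (nm_ge _ i j); rewrite mxE e ab_dom// -e.
exact: le_lt_trans (nm_ge N i j) h.
Qed.


Lemma nm_pow (M : 'M_2) : M != 0 -> exists n : int, nm M = q ^ n.
Proof.
move=> /nm_gt0; have [i [j ->]] := nm_attained M.
by rewrite ab_gt0 => /(place_val pl).
Qed.

Lemma nm_adj (M : 'M[K]_2) : nm (\adj M) <= nm M.
Proof.
apply: nm_le => [|i j]; first exact: nm_ge0.
rewrite !mxE /cofactor abM abX abN ab1 expr1n mul1r det_mx11 !mxE.
exact: nm_ge.
Qed.

(** * Lattices and vertices *)

Lemma unif_lt1 : ab pi < 1.
Proof. by rewrite (place_unif pl) invf_lt1 ?q_gt1 ?q_gt0. Qed.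

Lemma unif_divide x : ab x < 1 -> ab (x / pi) <= 1.
Proof.
rewrite abM abV (place_unif pl) invrK -ler_pdivlMr ?q_gt0// div1r -exprN1.
by rewrite -[X in ab x < X](expr0z q) => /ab_lt.
Qed.

Definition lat m (B : 'M[K]_(2, m)) : set 'cV[K]_2 :=
  [set B *m c | c in [set c : 'cV[K]_m | forall i, val_ring ab (c i 0)]].

(** The product of the least dilation factors needed to fit each of the lattices
    spanned by [h] and [h'] into the other. *)
Definition mxdist (h h' : 'M[K]_2) : R := nm (invmx h *m h') * nm (invmx h' *m h).

Definition rep (v : vertex ab) (h : 'M[K]_2) : Prop :=
  h \in unitmx /\ vertex_set v = homothety_class (lat h).

Lemma vertex_inj (v w : vertex ab) : vertex_set v = vertex_set w -> v = w.
Proof.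
by case: v w => [v pv] [w pw] /= e; case: _ / e pw => pw; congr MkVertex; exact: Prop_irrelevance.
Qed.

Lemma int_col m (c : 'cV[K]_m) : (forall i, val_ring ab (c i 0)) <-> nm c <= 1.
Proof.
split=> [h|h i]; last exact: le_trans (nm_ge _ _ _) h.
by apply: nm_le => // i j; rewrite (ord1 j); exact: h.
Qed.

Lemma lat_mul_sub m p (B : 'M[K]_(2, m)) (C : 'M[K]_(m, p)) : nm C <= 1 -> lat (B *m C) `<=` lat B.
Proof.
move=> C1 _ [c /int_col c1 <-]; exists (C *m c); last by rewrite mulmxA.
by apply/int_col; rewrite -[leRHS]mul1r nmM_le.
Qed.

Lemma lat_sub (h h' : 'M[K]_2) : h \in unitmx ->
  (lat h' `<=` lat h) <-> nm (invmx h *m h') <= 1.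
Proof.
move=> uh; split=> [hs|h1]; last first.
  by rewrite -(mulKVmx uh h'); exact: lat_mul_sub.
apply: nm_le => // i j.
have /hs[c c1 e] : lat h' (h' *m delta_mx j 0).
  exists (delta_mx j 0) => // k; rewrite /val_ring /= mxE.
  by case: (_ && _); rewrite ?ab1 ?ab0.
have -> : (invmx h *m h') i j = c i 0; last exact: c1.
rewrite -(mulKmx uh c) e mulmxA.
by rewrite -colE [RHS]mxE.
Qed.

Lemma lat_scale c (h : 'M[K]_2) : [set c *: x | x in lat h] = lat (c *: h).
Proof. by rewrite /lat image_comp; apply: eq_imagel => x _ /=; rewrite scalemxAl. Qed.

Lemma invmxZ c (h : 'M[K]_2) : c != 0 -> h \in unitmx -> invmx (c *: h) = c^-1 *: invmx h.
Proof.
move=> c0 uh; apply: (can_inj (mulKmx (_ : (c *: h) \in unitmx))); last first.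
  by rewrite mulmxV ?unitmxZ ?unitfE// -scalemxAl -scalemxAr scalerA divff// scale1r mulmxV.
by rewrite unitmxZ ?unitfE.
Qed.

Lemma mxdistZ c c' h h' : c != 0 -> c' != 0 -> h \in unitmx -> h' \in unitmx ->
  mxdist (c *: h) (c' *: h') = mxdist h h'.
Proof.
move=> c0 c0' uh uh'; rewrite /mxdist !invmxZ// -!scalemxAl -!scalemxAr !scalerA !nmZ.
by rewrite !abM !abV; field; rewrite !ab_eq0 c0 c0'.
Qed.

Lemma mxdist_tri h1 h2 h3 : h1 \in unitmx -> h2 \in unitmx -> h3 \in unitmx ->
  mxdist h1 h3 <= mxdist h1 h2 * mxdist h2 h3.
Proof.
move=> u1 u2 u3; rewrite /mxdist.
rewrite -{1}(mulKVmx u2 h3) -{2}(mulKVmx u2 h1) !mulmxA.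
rewrite -[_ *m invmx h2 *m h3]mulmxA -[_ *m invmx h2 *m h1]mulmxA.
apply: le_trans (ler_pM _ _ (nmM _ _) (nmM _ _)) _; rewrite ?nm_ge0//.
by rewrite le_eqVlt; apply/orP; left; apply/eqP; ring.
Qed.

Lemma rep_eq_dist v h h' : rep v h -> rep v h' -> mxdist h h' <= 1.
Proof.
move=> [uh e] [uh' e']; have : homothety_class (lat h) (lat h').
  rewrite -e e'; exists 1; first exact: oner_neq0.
  by rewrite lat_scale scale1r.
move=> [c c0]; rewrite lat_scale => eL.
rewrite -(mxdistZ c0 (oner_neq0 _))// scale1r.
have uch : c *: h \in unitmx by rewrite unitmxZ ?unitfE.
by rewrite mulr_ile1 ?nm_ge0//; apply/lat_sub => //; rewrite eL.
Qed.

(** If [L / L'] is isomorphic to the residue field then it is killed by [pi], so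
    that [pi L] is contained in [L'], itself contained in [L]. *)
Lemma adjacent_dist v w h h' : rep v h -> rep w h' -> adjacent v w ->
  mxdist h h' <= q.
Proof.
move=> [uh ev] [uh' ew] [L [L' []]]; rewrite ev ew.
move=> [c c0 ->] [c' c0' ->] + [phi [phiO _ phiZ phim _]].
rewrite !lat_scale in phiO phiZ phim *; rewrite -(mxdistZ c0 c0')//.
move/lat_sub; rewrite unitmxZ ?unitfE// => /(_ uh) hle.
rewrite -[q]mul1r ler_pM ?nm_ge0//.
have : lat (pi *: (c *: h)) `<=` lat (c' *: h').
  rewrite -lat_scale => _ [x Lx <-]; apply/phim.
    case: Lx => y y1 <-; exists (pi *: y); last by rewrite scalemxAr.
    by apply/int_col; rewrite nmZ mulr_ile1 ?ab_ge0 ?nm_ge0 ?(ltW unif_lt1)//; exact/int_col.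
  have h1 : ab (phi (pi *: x) - pi * phi x) < 1 by apply: phiZ => //; exact/ltW/unif_lt1.
  rewrite /val_max_ideal /= -(subrK (pi * phi x) (phi _)); apply: ab_add_lt => //.
  rewrite abM; apply: le_lt_trans unif_lt1.
  by rewrite ler_piMr ?ab_ge0//; exact: phiO.
move/lat_sub; rewrite unitmxZ ?unitfE// => /(_ uh').
by rewrite -scalemxAr nmZ (place_unif pl) mulrC ler_pdivrMr ?q_gt0// mul1r.
Qed.

(** ** Triangular representatives *)

Definition hnf (t u : K) : 'M[K]_2 := \matrix_(i, j)
  (if i == 0 then (if j == 0 then t else u) else (if j == 0 then 0 else 1)).

Lemma det_hnf t u : \det (hnf t u) = t.
Proof. by rewrite det2 !mxE /= mulr0 subr0 mulr1. Qed.

Lemma hnf_unit t u : (hnf t u \in unitmx) = (t != 0).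
Proof. by rewrite unitmxE det_hnf unitfE. Qed.

Lemma hnfM t u t' u' : hnf t u *m hnf t' u' = hnf (t * t') (t * u' + u).
Proof.
by apply/matrixP; elim/ord2P; elim/ord2P; rewrite mulmx2E !mxE /=; ring.
Qed.

Lemma hnf1 : hnf 1 0 = 1%:M.
Proof. by apply/matrixP; elim/ord2P; elim/ord2P; rewrite !mxE. Qed.

Lemma hnfV t u : t != 0 -> invmx (hnf t u) = hnf t^-1 (- (u / t)).
Proof.
move=> t0; have ut : hnf t u \in unitmx by rewrite hnf_unit.
apply: (can_inj (mulKmx ut)); rewrite mulmxV// hnfM divff// -hnf1.
by congr hnf; field.
Qed.

Definition join_radius (t u t' u' : K) : R :=
  Num.max (ab t) (Num.max (ab t') (ab (u' - u))).

Lemma nm_hnfVM t u t' u' : t != 0 ->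
  nm (invmx (hnf t u) *m hnf t' u') = join_radius t u t' u' / ab t.
Proof.
move=> t0; have at0 : 0 < ab t by rewrite ab_gt0.
rewrite hnfV// hnfM.
have -> : t^-1 * u' + - (u / t) = (u' - u) / t by field.
rewrite [t^-1 * _]mulrC /join_radius.
rewrite !maxr_pMl ?invr_ge0 ?ab_ge0// divff ?ab_eq0// -!abV -!abM.
apply/eqP; rewrite eq_le; apply/andP; split.
  apply: nm_le => [|]; first by rewrite le_max ler01.
  by elim/ord2P; elim/ord2P; rewrite !mxE /= !le_max ?lexx ?orbT// ?ab0 ?ab1 ?ler01 ?lexx.
rewrite !ge_max; have h := nm_ge (hnf (t' / t) ((u' - u) / t)).
apply/and3P; split.
- by have := h 1 1; rewrite mxE /= ab1.
- by have := h 0 0; rewrite mxE.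
- by have := h 0 1; rewrite mxE.
Qed.

Lemma join_radiusC t u t' u' : join_radius t u t' u' = join_radius t' u' t u.
Proof. by rewrite /join_radius maxCA abB. Qed.

Lemma mxdist_hnf t u t' u' : t != 0 -> t' != 0 ->
  mxdist (hnf t u) (hnf t' u') = join_radius t u t' u' ^+ 2 / (ab t * ab t').
Proof.
move=> t0 t0'; rewrite /mxdist !nm_hnfVM// (join_radiusC t' u').
by field; rewrite !ab_eq0 t0 t0'.
Qed.

Lemma lat_eq (h h' : 'M[K]_2) : h \in unitmx -> h' \in unitmx -> mxdist h h' <= 1 ->
  nm (invmx h *m h') = 1 -> lat h = lat h'.
Proof.
move=> uh uh' hd h1; rewrite /mxdist h1 mul1r in hd.
by apply/seteqP; split; apply/lat_sub; rewrite ?h1.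
Qed.

(** Reduction to Hermite normal form: the last coordinates of the generators
    generate a principal ideal, and clearing them leaves generators of the
    kernel, which is again principal. *)
Lemma lattice_hnf L : is_lattice ab L ->
  exists c t u, [/\ c != 0, t != 0 & L = lat (c *: hnf t u)].
Proof.
move=> [m [B [rB ->]]]; have fB : row_free B by rewrite /row_free rB.
have free (v : 'rV_2) : v *m B = 0 -> v = 0.
  by move=> e; apply: (row_free_inj fB); rewrite e mul0mx.
have maxex (f : 'I_m -> K) : (exists j, f j != 0) ->
    exists2 j, f j != 0 & forall k, ab (f k / f j) <= 1.
  move=> [j0 fj0].
  have [j _ hj] := @arg_maxP _ _ _ j0 xpredT (fun j => ab (f j)) isT.
  have fj : f j != 0 by rewrite -ab_gt0 (lt_le_trans _ (hj j0 isT))// ab_gt0.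
  by exists j => // k; rewrite abM abV ler_pdivrMr ?ab_gt0// mul1r; exact: hj.
have nz (v : 'rV_2) : v != 0 -> exists j, (v *m B) 0 j != 0.
  move=> v0; apply/existsP; apply: contra_neqT v0.
  rewrite negb_exists => /forallP h; apply: free; apply/rowP => j.
  by rewrite [RHS]mxE; apply/eqP; have := h j; rewrite negbK.
have rowE a b j : ((\row_(i < 2) if i == 0 then a else b) *m B) 0 j =
    a * B 0 j + b * B 1 j by rewrite mulmx2E !mxE.
(* the last coordinates of the generators span the ideal generated by [B 1 j] *)
have [j dj hj] : exists2 j, B 1 j != 0 & forall k, ab (B 1 k / B 1 j) <= 1.
  apply: (maxex (B 1)); have [|j] := nz (\row_(i < 2) if i == 0 then 0 else 1).
    by apply/eqP => /rowP/(_ 1); rewrite !mxE /= => /eqP; rewrite oner_eq0.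
  by rewrite rowE mul0r add0r mul1r => h; exists j.
(* [t k] is the first coordinate of the k-th generator once the last one has
   been cleared by subtracting a multiple of the j-th generator *)
pose t k := B 0 k - B 0 j / B 1 j * B 1 k.
have [k tk hk] : exists2 k, t k != 0 & forall l, ab (t l / t k) <= 1.
  apply: (maxex t).
  have [|k] := nz (\row_(i < 2) if i == 0 then 1 else - (B 0 j / B 1 j)).
    by apply/eqP => /rowP/(_ 0); rewrite !mxE /= => /eqP; rewrite oner_eq0.
  by rewrite rowE mul1r mulNr => h; exists k.
have minor_neq0 : B 0 k * B 1 j - B 0 j * B 1 k != 0.
  have -> : B 0 k * B 1 j - B 0 j * B 1 k = t k * B 1 j by rewrite /t; field.
  by rewrite mulf_neq0.
exists (B 1 j), (t k / B 1 j), (B 0 j / B 1 j); split => //.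
  by rewrite mulf_neq0 ?invr_eq0.
set h := _ *: hnf _ _.
have -> : B = h *m \matrix_(i < 2, l < m) (if i == 0 then t l / t k else B 1 l / B 1 j).
  apply/matrixP => i l; move: i; elim/ord2P; rewrite mulmx2E !mxE /= /t; field => //.
    by rewrite dj minor_neq0.
  by rewrite dj minor_neq0.
set C := \matrix_(_, _) _.
have C1 : nm C <= 1 by apply: nm_le => //; elim/ord2P => l; rewrite mxE /=.
(* [C] and [E] express the two families of generators in terms of each other *)
pose E : 'M[K]_(m, 2) := \matrix_(l, i)
  if i == 0 then (l == k)%:R - B 1 k / B 1 j * (l == j)%:R else (l == j)%:R.
have int01 (b : bool) : ab b%:R <= 1 by case: b; rewrite ?ab1 ?ab0.
have E1 : nm E <= 1.
  apply: nm_le => // l; elim/ord2P; rewrite mxE /= ?int01//.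
  by apply: ab_sub => //; rewrite abM mulr_ile1 ?ab_ge0.
have CE : C *m E = 1%:M.
  apply/matrixP => i i'; rewrite mxE.
  have -> : \sum_l C i l * E l i' = if i' == 0 then C i k - B 1 k / B 1 j * C i j else C i j.
    have del r : \sum_l C i l * (l == r)%:R = C i r.
      rewrite (bigD1 r)//= eqxx mulr1 big1 ?addr0// => l /negPf ->.
      by rewrite mulr0.
    case: ifP => i0; under eq_bigr => l _ do rewrite [E _ _]mxE i0; last exact: del.
    under eq_bigr => l _ do rewrite mulrBr mulrCA.
    by rewrite big_split /= sumrN -mulr_sumr !del.
  by move: i i'; elim/ord2P; elim/ord2P; rewrite !mxE /= /t; field; rewrite ?dj ?minor_neq0.
apply/seteqP; split; first exact: lat_mul_sub.
by rewrite -{1}(mulmx1 h) -CE mulmxA; exact: lat_mul_sub.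
Qed.

Lemma rep_exists v : exists t u, t != 0 /\ rep v (hnf t u).
Proof.
have [L /lattice_hnf[c [t [u [c0 t0 eL]]]] ev] := vertexP v.
exists t, u; split => //; split; first by rewrite hnf_unit.
rewrite ev eL; apply/seteqP; split=> L' [d d0 ->]; rewrite lat_scale.
  by exists (d * c); rewrite ?mulf_neq0 ?lat_scale ?scalerA.
by exists (d / c); rewrite ?mulf_neq0 ?invr_eq0 ?lat_scale ?scalerA ?divfK.
Qed.

Lemma walk_dist n v w h h' : rep v h -> rep w h' -> walk n v w ->
  mxdist h h' <= q ^+ n.
Proof.
elim: n v h => [|n IH] v h rv rw /=.
  by move=> e; rewrite expr0; apply: (@rep_eq_dist v); rewrite // e.
case=> u vu uw; have [t [x [_ ru]]] := rep_exists u.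
have [uh uh' uu] := (And3 (proj1 rv) (proj1 rw) (proj1 ru)).
rewrite exprS; apply: le_trans (mxdist_tri uh uu uh') _.
by rewrite ler_pM ?(adjacent_dist rv ru)// ?(IH _ _ ru)// /mxdist mulr_ge0 ?nm_ge0.
Qed.

(** ** Walks between balls *)

Lemma is_vertex_lat h : h \in unitmx -> is_vertex ab (homothety_class (lat h)).
Proof.
move=> uh; exists (lat h) => //; exists 2%N, h; split => //.
exact: mxrank_unit.
Qed.

Lemma rep_vertex h : h \in unitmx -> exists v, rep v h.
Proof. by move=> uh; exists (MkVertex (is_vertex_lat uh)). Qed.

Lemma lat_in v c h : c != 0 -> rep v h -> vertex_set v (lat (c *: h)).
Proof. by move=> c0 [_ ->]; exists c; rewrite ?lat_scale. Qed.

(** The [k]-th coordinate in the basis [h] induces the isomorphism of the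
    quotient with the residue field. *)
Lemma adjacent_coord (v w : vertex ab) h (k : 'I_2) : h \in unitmx -> vertex_set v (lat h) ->
  vertex_set w [set h *m c | c in [set c : 'cV[K]_2 | nm c <= 1 /\ ab (c k 0) < 1]] ->
  adjacent v w.
Proof.
move=> uh vL wL'.
exists (lat h), [set h *m c | c in [set c : 'cV[K]_2 | nm c <= 1 /\ ab (c k 0) < 1]].
split=> //; first by move=> _ [c [c1 _] <-]; exists c => //; exact/int_col.
exists (fun x => (invmx h *m x) k 0); split.
- by move=> _ [c c1 <-]; rewrite mulKmx//; exact: c1.
- by move=> x y _ _; rewrite mulmxDr mxE subrr /val_max_ideal /= ab0.
- by move=> a x _ _; rewrite -scalemxAr mxE subrr /val_max_ideal /= ab0.
- move=> _ [c /int_col c1 <-]; rewrite mulKmx//; split=> [ck|]; first by exists c.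
  by move=> [d [_ dk] /(can_inj (mulKmx uh)) <-].
- move=> y y1; exists (h *m (y *: delta_mx k 0)).
    exists (y *: delta_mx k 0) => // i; rewrite !mxE /val_ring /=.
    by case: (_ && _); rewrite ?mulr1 ?mulr0 ?ab0.
  by rewrite mulKmx// !mxE !eqxx mulr1 subrr /val_max_ideal /= ab0.
Qed.

Lemma nm_col2 (c : 'cV[K]_2) : nm c <= 1 <-> ab (c 0 0) <= 1 /\ ab (c 1 0) <= 1.
Proof.
split=> [h|[h0 h1]]; first by split; exact: le_trans (nm_ge _ _ _) h.
by apply: nm_le => // i j; rewrite (ord1 j); move: i; apply: ord2P.
Qed.

Lemma adjacent_down v w t u : t != 0 -> rep v (hnf t u) -> rep w (hnf (pi * t) u) ->
  adjacent v w.
Proof.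
move=> t0 rv rw; apply: (@adjacent_coord v w (hnf t u) 0); first by rewrite hnf_unit.
  by rewrite -[hnf t u]scale1r; exact: lat_in (oner_neq0 _) rv.
have := lat_in (oner_neq0 _) rw; rewrite scale1r; congr (vertex_set w _).
have -> : hnf (pi * t) u = hnf t u *m hnf pi 0 by rewrite hnfM mulr0 add0r mulrC.
apply/seteqP; split=> [_ [c /int_col/nm_col2[c0 c1] <-]|_ [c [/nm_col2[c0 c1] c0'] <-]].
  exists (hnf pi 0 *m c); last by rewrite mulmxA.
  have e0 : (hnf pi 0 *m c) 0 0 = pi * c 0 0 by rewrite mulmx2E !mxE /=; ring.
  have e1 : (hnf pi 0 *m c) 1 0 = c 1 0 by rewrite mulmx2E !mxE /=; ring.
  have h : ab (pi * c 0 0) < 1.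
    by rewrite abM; apply: le_lt_trans unif_lt1; rewrite ler_piMr ?ab_ge0.
  by split; [apply/nm_col2; rewrite e0 e1 ltW | rewrite e0].
exists (hnf pi^-1 0 *m c); last first.
  rewrite mulmxA -(mulmxA (hnf t u)) hnfM mulr0 addr0 divff ?pi_neq0//.
  by rewrite hnf1 mulmx1.
apply/int_col/nm_col2; rewrite !mulmx2E !mxE /= !mul0r !addr0 add0r mul1r.
by rewrite mulrC unif_divide.
Qed.

Lemma adjacent_up v w t u : t != 0 -> rep v (hnf (pi * t) u) -> rep w (hnf t u) ->
  adjacent v w.
Proof.
move=> t0 rv rw; have pt0 : pi * t != 0 by rewrite mulf_neq0 ?pi_neq0.
apply: (@adjacent_coord v w (hnf (pi * t) u) 1); first by rewrite hnf_unit.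
  by rewrite -[hnf _ u]scale1r; exact: lat_in (oner_neq0 _) rv.
have := lat_in pi_neq0 rw; congr (vertex_set w _).
have e (c : 'cV_2) : pi *: hnf t u *m c = hnf (pi * t) u *m
    (\col_i if i == 0 then c 0 0 else pi * c 1 0).
  by apply/matrixP => i j; rewrite (ord1 j) !mulmx2E !mxE; move: i; apply: ord2P => /=; ring.
apply/seteqP; split=> [_ [c /int_col/nm_col2[c0 c1] <-]|_ [c [/nm_col2[c0 c1] c1'] <-]].
  rewrite e; eexists; last reflexivity.
  have h : ab (pi * c 1 0) < 1.
    by rewrite abM; apply: le_lt_trans unif_lt1; rewrite ler_piMr ?ab_ge0.
  by split; [apply/nm_col2; rewrite !mxE /= (ltW h) | rewrite mxE].
exists (\col_i if i == 0 then c 0 0 else c 1 0 / pi).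
  by apply/int_col/nm_col2; rewrite !mxE /=; split => //; exact: unif_divide.
rewrite e; congr (_ *m _); apply/matrixP => i j; rewrite (ord1 j) !mxE.
move: i; apply: ord2P => //=.
by field; exact: pi_neq0.
Qed.

Lemma walk_cat m n (v w x : vertex ab) : walk m v w -> walk n w x -> walk (m + n) v x.
Proof.
elim: m v => [|m IH] v /=; first by move=> ->.
by case=> u vu uw wx; exists u => //; exact: IH.
Qed.

Lemma walk_down n v w t u : t != 0 -> rep v (hnf t u) -> rep w (hnf (pi ^+ n * t) u) ->
  walk n v w.
Proof.
elim: n v t => [|n IH] v t t0 rv rw /=.
  by apply: vertex_inj; rewrite (proj2 rv) (proj2 rw) expr0 mul1r.
have pt0 : pi * t != 0 by rewrite mulf_neq0 ?pi_neq0.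
have [x rx] : exists x, rep x (hnf (pi * t) u) by apply: rep_vertex; rewrite hnf_unit.
exists x; first exact: adjacent_down rv rx.
by apply: (IH _ _ pt0 rx); rewrite mulrA -exprSr.
Qed.

Lemma walk_up n v w t u : t != 0 -> rep v (hnf (pi ^+ n * t) u) -> rep w (hnf t u) ->
  walk n v w.
Proof.
elim: n v => [|n IH] v t0 rv rw /=.
  by apply: vertex_inj; rewrite (proj2 rv) (proj2 rw) expr0 mul1r.
have [x rx] : exists x, rep x (hnf (pi ^+ n * t) u).
  by apply: rep_vertex; rewrite hnf_unit mulf_neq0 ?expf_neq0 ?pi_neq0.
exists x; last exact: IH.
apply: (adjacent_up _ _ rx); first by rewrite mulf_neq0 ?expf_neq0 ?pi_neq0.
by rewrite mulrA -exprS.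
Qed.

Lemma rep_ball v t u t' u' : t != 0 -> ab t = ab t' -> ab (u - u') <= ab t ->
  rep v (hnf t u) -> rep v (hnf t' u').
Proof.
move=> t0 et eu [uh ev]; have t0' : t' != 0 by rewrite -ab_eq0 -et ab_eq0.
have ej : join_radius t u t' u' = ab t.
  by rewrite /join_radius -et maxA maxxx; apply/max_idPl; rewrite abB.
split; first by rewrite hnf_unit.
rewrite ev; congr homothety_class; apply: lat_eq; rewrite ?hnf_unit//.
  by rewrite mxdist_hnf// ej -et expr2 divff// mulf_neq0 ?ab_eq0.
by rewrite nm_hnfVM// ej divff ?ab_eq0.
Qed.

Lemma unif_scale t t' : t != 0 -> t' != 0 -> ab t <= ab t' ->
  exists n : nat, ab t = ab (pi ^+ n * t').
Proof.
move=> t0 t0'; have [m em] := place_val pl t0; have [m' em'] := place_val pl t0'.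
rewrite em em' ler_eXz2l ?q_gt1// => le.
exists `|m' - m|%N; rewrite abM abpi em' exprnN -expfzDr ?q_neq0//; congr (_ ^ _); lia.
Qed.

(** A geodesic climbs from one ball to the smallest ball containing both, then
    descends to the other. *)
Lemma walk_hnf v w t u t' u' : t != 0 -> t' != 0 ->
  rep v (hnf t u) -> rep w (hnf t' u') ->
  exists2 n, walk n v w & q ^+ n = mxdist (hnf t u) (hnf t' u').
Proof.
move=> t0 t0' rv rw.
have [s es] : exists s, ab s = join_radius t u t' u'.
  rewrite /join_radius /Num.max; case: ifP => _; last by exists t.
  by case: ifP => _; [exists (u' - u) | exists t'].
have [ts ts' us] : [/\ ab t <= ab s, ab t' <= ab s & ab (u' - u) <= ab s].
  by rewrite es /join_radius !le_max !lexx !orbT.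
have s0 : s != 0 by rewrite -ab_gt0 (lt_le_trans _ ts)// ab_gt0.
have [n en] := unif_scale t0 s0 ts; have [n' en'] := unif_scale t0' s0 ts'.
have [x rx] : exists x, rep x (hnf s u) by apply: rep_vertex; rewrite hnf_unit.
exists (n + n')%N.
  apply: (@walk_cat _ _ _ x).
    by apply: (walk_up s0 _ rx); apply: rep_ball rv => //; rewrite subrr ab0 ab_ge0.
  apply: (@walk_down _ _ _ s u' s0); first by apply: rep_ball rx; rewrite // abB.
  by apply: rep_ball rw => //; rewrite subrr ab0 ab_ge0.
rewrite mxdist_hnf// -es en en' !abM !abpi exprD.
have := expf_neq0 n q_neq0; have := expf_neq0 n' q_neq0; have : ab s != 0 by rewrite ab_eq0.
by move=> *; field; apply/and3P.
Qed.

(** No walk is shorter, by [walk_dist], and [walk_hnf] attains the bound; the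
    general case follows because [mxdist] is the same for all representatives of
    a vertex. *)
Lemma tree_distP v w h h' : rep v h -> rep w h' ->
  q ^+ tree_dist v w = mxdist h h'.
Proof.
move=> rv rw; have [t [u [t0 rv']]] := rep_exists v.
have [t' [u' [t0' rw']]] := rep_exists w.
have [n wn en] := walk_hnf t0 t0' rv' rw'.
have nmin m : walk m v w -> (n <= m)%N.
  move=> /(walk_dist rv' rw'); rewrite -en ler_eXn2l ?q_gt1//.
have -> : tree_dist v w = n.
  apply: xget_unique => // m [wm mmin]; apply/eqP.
  by rewrite eqn_leq nmin// mmin.
have [uv uw uv' uw'] := And4 (proj1 rv) (proj1 rw) (proj1 rv') (proj1 rw').
apply/eqP; rewrite en eq_le; apply/andP; split.
  apply: le_trans (mxdist_tri uv' uv uw') _.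
  rewrite -[leRHS]mul1r ler_pM ?(rep_eq_dist rv' rv) /mxdist ?mulr_ge0 ?nm_ge0//.
  apply: le_trans (mxdist_tri uv uw uw') _.
  by rewrite ler_piMr ?(rep_eq_dist rw rw') /mxdist ?mulr_ge0 ?nm_ge0.
apply: le_trans (mxdist_tri uv uv' uw) _.
rewrite -[leRHS]mul1r ler_pM ?(rep_eq_dist rv rv') /mxdist ?mulr_ge0 ?nm_ge0//.
apply: le_trans (mxdist_tri uv' uw' uw) _.
by rewrite ler_piMr ?(rep_eq_dist rw' rw) /mxdist ?mulr_ge0 ?nm_ge0.
Qed.

Lemma tree_dist_tri (u v w : vertex ab) :
  (tree_dist u w <= tree_dist u v + tree_dist v w)%N.
Proof.
have [t [x [_ ru]]] := rep_exists u; have [t' [x' [_ rv]]] := rep_exists v.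
have [t'' [x'' [_ rw]]] := rep_exists w.
rewrite -(ler_eXn2l q_gt1) exprD (tree_distP ru rw) (tree_distP ru rv) (tree_distP rv rw).
exact: mxdist_tri (proj1 ru) (proj1 rv) (proj1 rw).
Qed.

Lemma eq_exp_q m n : (q ^+ m == q ^+ n) = (m == n).
Proof. by rewrite eqn_leq -!(ler_eXn2l q_gt1) -eq_le. Qed.

Lemma tree_distC (v w : vertex ab) : tree_dist v w = tree_dist w v.
Proof.
have [t [x [_ rv]]] := rep_exists v; have [t' [x' [_ rw]]] := rep_exists w.
by apply/eqP; rewrite -eq_exp_q (tree_distP rv rw) (tree_distP rw rv) /mxdist mulrC.
Qed.

Lemma rep_inj v w h : rep v h -> rep w h -> v = w.
Proof. by move=> [_ ev] [_ ew]; apply: vertex_inj; rewrite ev ew. Qed.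

Lemma tree_dist_eq0 (v w : vertex ab) : tree_dist v w = 0%N <-> v = w.
Proof.
have [t [x [t0 rv]]] := rep_exists v; have [t' [x' [t0' rw]]] := rep_exists w.
have [n wn] := walk_hnf t0 t0' rv rw.
rewrite -(tree_distP rv rw) => /eqP; rewrite eq_exp_q => /eqP en; split=> [e|e].
  by rewrite -en in e; move: wn; rewrite e.
rewrite -e in rw; apply/eqP; rewrite -leqn0 -(ler_eXn2l q_gt1) -e (tree_distP rv rv).
by rewrite expr0 (rep_eq_dist rv rv).
Qed.

(** ** The action of SL2 *)

Lemma SL_unit (A : comUnitRingType) n (g : SL n A) : (g : 'M[A]_n) \in unitmx.
Proof. by rewrite unitmxE det_SL unitr1. Qed.

Lemma rep_act (g : SL 2 K) v h : rep v h -> rep (act g v) ((g : 'M[K]_2) *m h).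
Proof.
move=> [uh ev]; split; first by rewrite unitmx_mul SL_unit.
have gL (c : K) : [set (g : 'M[K]_2) *m x | x in [set c *: x | x in lat h]] =
    [set c *: x | x in lat ((g : 'M[K]_2) *m h)].
  rewrite !image_comp; apply: eq_imagel => x _ /=.
  by rewrite -scalemxAr mulmxA.
rewrite /= /act_set ev; apply/seteqP; split=> [_ [_ [c c0 ->] <-]|_ [c c0 ->]].
  by exists c.
by exists [set c *: x | x in lat h]; [exists c | exact: gL].
Qed.

Lemma act_dist (g : SL 2 K) (v w : vertex ab) :
  tree_dist (act g v) (act g w) = tree_dist v w.
Proof.
have [t [x [t0 rv]]] := rep_exists v; have [t' [x' [t0' rw]]] := rep_exists w.
apply/eqP; rewrite -eq_exp_q (tree_distP rv rw) (tree_distP (rep_act g rv) (rep_act g rw)).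
have e h h' : h \in unitmx -> invmx (g *m h) *m (g *m h') = invmx h *m h'.
  move=> uh; have ugh : (g : 'M_2) *m h \in unitmx by rewrite unitmx_mul SL_unit.
  by rewrite -{1}(mulKVmx uh h') (mulmxA (SL_mx g)) mulKmx.
by rewrite /mxdist !e ?(proj1 rv) ?(proj1 rw).
Qed.

Lemma actM (g g' : SL 2 K) (v : vertex ab) : act (g * g')%g v = act g (act g' v).
Proof.
have [t [x [t0 rv]]] := rep_exists v.
by apply: (rep_inj (rep_act _ rv)); rewrite /= -mulmxA; do 2!apply: rep_act.
Qed.

Lemma act1 (v : vertex ab) : act (1%g : SL 2 K) v = v.
Proof.
have [t [x [t0 rv]]] := rep_exists v.
by apply: (rep_inj (rep_act _ rv)); rewrite mul1mx.
Qed.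

Lemma invmx_adj (A : 'M[K]_2) : \det A = 1 -> invmx A = \adj A.
Proof. by move=> dA; rewrite /invmx unitmxE dA unitr1 invr1 scale1r. Qed.

Lemma nm_inv (A : 'M[K]_2) : \det A = 1 -> nm (invmx A) = nm A.
Proof.
move=> dA; apply/eqP; rewrite eq_le; apply/andP; split.
  by rewrite invmx_adj// nm_adj.
rewrite -{1}(invmxK A) invmx_adj ?nm_adj//.
by rewrite det_inv dA invr1.
Qed.

(** A matrix of determinant 1 has the same norm as its inverse, so both factors of
    [mxdist] are equal. *)
Lemma act_disp (g : SL 2 K) v h : rep v h ->
  q ^+ tree_dist v (act g v) = nm (invmx h *m g *m h) ^+ 2.
Proof.
move=> rv; have uh := proj1 rv.
rewrite (tree_distP rv (rep_act g rv)) /mxdist mulmxA expr2; congr (_ * _).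
rewrite -[RHS]nm_inv.
  congr nm; rewrite -mulmxA; apply: (can_inj (mulKmx (_ : invmx h *m (g *m h) \in unitmx))).
    by rewrite !unitmx_mul unitmx_inv uh SL_unit.
  rewrite mulmxV ?unitmx_mul ?unitmx_inv ?uh ?SL_unit//.
  by rewrite -mulmxA mulKVmx ?mulVmx// unitmx_mul SL_unit.
by rewrite !det_mulmx det_SL mulr1 -det_mulmx mulVmx ?det1.
Qed.

Lemma nm_le_disp (g : SL 2 K) v h : rep v h ->
  nm g <= nm h * q ^+ tree_dist v (act g v) * nm (invmx h).
Proof.
move=> rv; have uh := proj1 rv.
have {1}-> : SL_mx g = h *m (invmx h *m g *m h) *m invmx h.
  by rewrite -!mulmxA mulmxV// mulmx1 mulKVmx.
apply: nmM_le => //; apply: nmM_le => //; rewrite (act_disp _ rv) expr2 ler_peMr ?nm_ge0//.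
rewrite -(@ler_pXn2r _ 2) ?nnegrE ?nm_ge0// -(act_disp _ rv) expr1n.
by rewrite exprn_ege1// ltW ?q_gt1.
Qed.

Lemma nm_conj_pow (g : SL 2 K) h : h \in unitmx ->
  exists n : int, nm (invmx h *m g *m h) = q ^ n.
Proof.
move=> uh; apply: nm_pow; apply/eqP => e; have := SL_unit g.
by rewrite unitmxE -(mulmxK uh (SL_mx g)) -(mulKVmx uh (_ *m h)) (mulmxA (invmx h)) e
  mulmx0 mul0mx det0 unitr0.
Qed.

(** * Horospheres *)

(** A centre of the ball associated with a vertex, and an element of [K] whose
    absolute value is the radius of that ball; both are chosen. *)
Definition ball (v : vertex ab) : K * K :=
  xget (1, 0) [set p : K * K | p.1 != 0 /\ rep v (hnf p.1 p.2)].

Lemma ballP v : (ball v).1 != 0 /\ rep v (hnf (ball v).1 (ball v).2).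
Proof.
have [t [u h]] := rep_exists v.
by apply: (@xgetPex _ (1, 0) [set p : K * K | p.1 != 0 /\ rep v (hnf p.1 p.2)]); exists (t, u).
Qed.

(** The exponential of the opposite of the Busemann function of the end of the
    tree towards which balls grow. *)
Definition rho v : R := ab (ball v).1.

Lemma rho_gt0 v : 0 < rho v. Proof. by rewrite ab_gt0 (ballP v).1. Qed.

Lemma dist_ball v w : q ^+ tree_dist v w * (rho v * rho w) =
  join_radius (ball v).1 (ball v).2 (ball w).1 (ball w).2 ^+ 2.
Proof.
have [t0 rv] := ballP v; have [t0' rw] := ballP w.
by rewrite (tree_distP rv rw) mxdist_hnf// divfK// mulf_neq0 ?ab_eq0.
Qed.

Lemma join_radius_pow t u t' u' : t != 0 -> exists j : nat, join_radius t u t' u' = ab t * q ^+ j.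
Proof.
move=> t0.
have [s es] : exists s, ab s = join_radius t u t' u'.
  rewrite /join_radius /Num.max; case: ifP => _; last by exists t.
  by case: ifP => _; [exists (u' - u) | exists t'].
have ts : ab t <= ab s by rewrite es le_max lexx.
have s0 : s != 0 by rewrite -ab_gt0 (lt_le_trans _ ts)// ab_gt0.
have [n en] := unif_scale t0 s0 ts; exists n.
by rewrite -es en abM abpi mulrAC mulVf ?mul1r// expf_neq0 ?q_neq0.
Qed.

(** The smallest ball containing those of [v] and [w] is obtained by climbing [j]
    steps from [v]; descending to [w] takes the rest of the geodesic. *)
Lemma horo_range v w : exists2 j, (j <= tree_dist v w)%N &
  rho w * q ^+ tree_dist v w = rho v * q ^+ j.*2 /\
  join_radius (ball v).1 (ball v).2 (ball w).1 (ball w).2 = rho v * q ^+ j.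
Proof.
have [t0 _] := ballP v.
have [j ej] := join_radius_pow (ball v).2 (ball w).1 (ball w).2 t0.
have := dist_ball v w; rewrite ej -/(rho v) => e.
have rv := rho_gt0 v; have rw := rho_gt0 w.
have e2 : rho w * q ^+ tree_dist v w = rho v * q ^+ j.*2.
  apply: (mulfI (lt0r_neq0 rv)); rewrite -addnn exprD.
  by rewrite [LHS]mulrA [LHS]mulrC e expr2 mulrACA -mulrA.
exists j => //; rewrite -(ler_eXn2l q_gt1).
have le : rho w <= rho v * q ^+ j.
  by rewrite /rho -ej /join_radius !le_max lexx orbT.
have qj : 0 < q ^+ j by rewrite exprn_gt0 ?q_gt0.
have ql : 0 < q ^+ tree_dist v w by rewrite exprn_gt0 ?q_gt0.
have := ler_wpM2r (ltW ql) le; rewrite e2 -addnn exprD -mulrA.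
by rewrite ler_pM2l// ler_pM2l.
Qed.

Definition horo_index v w : nat := s2val (cid2 (horo_range v w)).

Lemma horo_index_le v w : (horo_index v w <= tree_dist v w)%N.
Proof. exact: s2valP (cid2 (horo_range v w)). Qed.

Lemma rho_horo v w : rho w * q ^+ tree_dist v w = rho v * q ^+ (horo_index v w).*2.
Proof. by have [] := s2valP' (cid2 (horo_range v w)). Qed.

(** The centre of [w] relative to that of [v], in the unit given by the smallest
    ball containing both when the geodesic climbs [j] steps. *)
Definition horo_code v l j w : (l - j).-tuple F :=
  digits (l - j) (((ball w).2 - (ball v).2) / ((ball v).1 / pi ^+ j)).

(** Balls of the same radius coincide as soon as their centres agree up to that
    radius, which is [l - j] digits below the radius of the smallest ball
    containing those of [v] and [w]. Hence at most q^(l - j) vertices are reached from [v] by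
    climbing [j] steps and descending [l - j] steps. *)
Lemma horo_inj v l j w w' : (j <= l)%N ->
  tree_dist v w = l -> tree_dist v w' = l ->
  rho w * q ^+ l = rho v * q ^+ j.*2 -> rho w' * q ^+ l = rho v * q ^+ j.*2 ->
  horo_code v l j w = horo_code v l j w' -> w = w'.
Proof.
move=> jl dw dw' rw rw'; have qj n : 0 < q ^+ n by rewrite exprn_gt0 ?q_gt0.
have rv0 := rho_gt0 v.
have tau : ab ((ball v).1 / pi ^+ j) = rho v * q ^+ j.
  by rewrite abM abV abpi invrK.
have center x : tree_dist v x = l -> rho x * q ^+ l = rho v * q ^+ j.*2 ->
    ab (((ball x).2 - (ball v).2) / ((ball v).1 / pi ^+ j)) <= 1.
  move=> dx rx; have [i _] := horo_range v x; rewrite dx rx => -[/(mulfI (lt0r_neq0 rv0)) /eqP].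
  rewrite eq_exp_q => /eqP /double_inj <- ei.
  rewrite abM abV tau ler_pdivrMr ?mulr_gt0// mul1r -ei.
  by rewrite /join_radius !le_max lexx !orbT.
move=> /(digits_inj (center _ dw rw) (center _ dw' rw')).
rewrite -mulrBl opprB addrA subrK abM abV tau ler_pdivrMr ?mulr_gt0// => le.
have [t0 r] := ballP w; have [t0' r'] := ballP w'.
have ew : rho w = rho w' by apply: (mulIf (lt0r_neq0 (qj l))); rewrite rw rw'.
apply: rep_inj _ r'; apply: rep_ball r => //.
apply: le_trans le _; rewrite le_eqVlt; apply/orP; left; apply/eqP.
apply: (mulIf (lt0r_neq0 (qj l))); rewrite -/(rho w) rw -{2}(subnK jl) exprD -addnn exprD.
by field; rewrite lt0r_neq0.
Qed.

End Place.

Section Completion.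
Variables (R : realType) (F : finFieldType) (K : fieldType) (a : K -> R).
Variables (iota : {rmorphism F -> K}) (pi : K) (Ka : completion a).
Hypothesis a_val : forall x, x != 0 -> exists n : int, a x = #|F|%:R ^ n.
Hypothesis a_unif : a pi = #|F|%:R^-1.
Hypothesis a_res : forall x, a x <= 1 -> exists c : F, a (x - iota c) < 1.

Let av := @compl_absP _ _ _ Ka.
Let emb := @compl_emb _ _ _ Ka.

(** An element of the completion has the same absolute value and the same residue
    as any sufficiently close element of [K]. *)
Lemma completion_place :
  place (@compl_abs _ _ _ Ka) (fun c => emb (iota c)) (emb pi).
Proof.
have [p _ pF] := finPcharP F.
have ultra := av_ultra av (rmorph_pchar emb (rmorph_pchar iota pF)).
split => //.
- move=> x x0; have ax : 0 < compl_abs x.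
    rewrite lt_def (av_ge0 av) andbT; apply: contra_neqN x0 => /eqP.
    exact: (av_eq0 av x).1.
  have [y hy] := compl_dense x ax.
  have e : compl_abs x = a y.
    rewrite -(@compl_abs_emb _ _ _ Ka); apply/eqP; rewrite eq_le; apply/andP; split.
      have := ultra (x - emb y) (emb y); rewrite subrK le_max => /orP[|//].
      by rewrite leNgt hy.
    have := ultra (emb y - x) x; rewrite subrK -opprB (avN av).
    by rewrite (max_idPr (ltW hy)).
  rewrite e; apply: a_val; apply: contraTneq ax => y0.
  rewrite e y0 -(@compl_abs_emb _ _ _ Ka) rmorph0 (proj2 (av_eq0 av 0))//.
  by rewrite ltxx.
- by rewrite compl_abs_emb.
- move=> x x1; have [y hy] := compl_dense x ltr01.
  have : a y <= 1.
    rewrite -(@compl_abs_emb _ _ _ Ka).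
    have := ultra (emb y - x) x; rewrite subrK -opprB (avN av).
    by move/le_trans; apply; rewrite ge_max x1 (ltW hy).
  move=> /a_res[c hc]; exists c.
  rewrite -(subrK (emb y) x) -addrA; apply: le_lt_trans (ultra _ _) _.
  by rewrite gt_max hy -rmorphB compl_abs_emb.
Qed.

End Completion.

(** * The two places of the rational function field *)

Lemma frac_cross (E : fieldType) (x a b a' b' : E) : b != 0 -> b' != 0 ->
  a / b = x * (a' / b') -> a * b' = x * (a' * b).
Proof. by move=> b0 b0' h; rewrite -[a](divfK b0) h; field. Qed.

Section RationalFunctions.
Variables (R : realType) (F : finFieldType).

Local Notation K := {fraction {poly F}}.
Local Notation "x %:F" := (tofrac x).
Local Notation q := (#|F|%:R : R).

Lemma fracP (f : K) : exists P Q : {poly F}, Q != 0 /\ f = P%:F / Q%:F.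
Proof.
elim/quotW: f => x; exists \n_x, \d_x; split; first exact: denom_ratioP.
have d0 : (\d_x)%:F != 0 by rewrite tofrac_eq0 denom_ratioP.
apply: (mulIf d0); rewrite divfK//.
unlock FracField.tofrac; rewrite -[LHS]FracField.pi_mul; apply/eqmodP => /=.
rewrite FracField.equivfE /FracField.mulf /= !numden_Ratio ?mulf_neq0 ?oner_neq0 ?denom_ratioP//.
by rewrite !mulr1 mulrC.
Qed.

Lemma X_factor (P : {poly F}) : P != 0 ->
  exists n P', ~~ ('X %| P') /\ P = 'X ^+ n * P'.
Proof.
move=> P0; have [n [P' nr e]] := multiplicity_XsubC P 0.
rewrite P0 subr0 /= -dvdp_XsubCl subr0 in nr e.
by exists n, P'; rewrite mulrC.
Qed.

Lemma X_ndvd0 (P : {poly F}) : ~~ ('X %| P) -> P != 0.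
Proof. by apply: contraNneq => ->; rewrite dvdp0. Qed.

Lemma zero_form (f : K) : f != 0 -> exists n : int, exists P Q : {poly F},
  [/\ ~~ ('X %| P), ~~ ('X %| Q) & f = 'X%:F ^ n * (P%:F / Q%:F)].
Proof.
have [P [Q [Q0 ->]]] := fracP f; rewrite mulf_eq0 invr_eq0 !tofrac_eq0 (negPf Q0) orbF.
move=> /X_factor[m [P' [nP ->]]]; have [n [Q' [nQ ->]]] := X_factor Q0.
exists (m%:Z - n%:Z), P', Q'; split => //.
rewrite expfzDr ?tofracX_neq0// -exprnN !rmorphM !rmorphXn /= -exprnP.
by rewrite invfM mulrACA.
Qed.

Lemma val_zeroE n (P Q : {poly F}) : ~~ ('X %| P) -> ~~ ('X %| Q) ->
  val_zero ('X%:F ^ n * (P%:F / Q%:F)) = n.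
Proof.
move=> nP nQ; apply: xget_unique; first by exists P, Q.
move=> m [P' [Q' [nP' nQ']]].
have nz := X_ndvd0; have pr (A B : {poly F}) : ~~ ('X %| A) -> ~~ ('X %| B) -> ~~ ('X %| A * B).
  by rewrite -['X]subr0 !dvdp_XsubCl rootM negb_or => -> ->.
wlog le : n m P Q P' Q' nP nQ nP' nQ' / (n <= m)%R.
  move=> wl e; have [le|/ltW le] := leP n m; first exact: (wl n m P Q P' Q').
  by apply/esym; apply: (wl m n P' Q' P Q).
move=> e; have [d ed] : exists d : nat, m = n + d%:Z by exists `|m - n|%N; lia.
have : P * Q' = 'X ^+ d * (P' * Q).
  apply/eqP; rewrite -tofrac_eq !rmorphM rmorphXn /=; apply/eqP.
  have Q0 : Q%:F != 0 by rewrite tofrac_eq0 nz.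
  have Q0' : Q'%:F != 0 by rewrite tofrac_eq0 nz.
  have Xn0 : ('X : {poly F})%:F ^ n != 0 by rewrite expfz_neq0 ?tofracX_neq0.
  have h : P%:F / Q%:F = 'X%:F ^+ d * (P'%:F / Q'%:F).
    by apply: (mulfI Xn0); rewrite [RHS]mulrA exprnP -expfzDr ?tofracX_neq0// -ed.
  exact: frac_cross Q0 Q0' h.
case: d ed => [|d] ed; first by rewrite ed addr0.
by move=> h; have := pr _ _ nP nQ'; rewrite h exprS -mulrA dvdp_mulr ?dvdpp.
Qed.
Lemma abs_zeroE n (P Q : {poly F}) : ~~ ('X %| P) -> ~~ ('X %| Q) ->
  abs_zero R ('X%:F ^ n * (P%:F / Q%:F)) = q ^ (- n).
Proof.
move=> nP nQ; rewrite /abs_zero val_zeroE// mulf_eq0 (negPf (expfz_neq0 _ _)) ?tofracX_neq0//=.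
by rewrite mulf_eq0 invr_eq0 !tofrac_eq0 (negPf (X_ndvd0 nP)) (negPf (X_ndvd0 nQ)).
Qed.

Lemma nX1 : ~~ ('X %| (1 : {poly F})).
Proof. by rewrite dvdp1 size_polyX. Qed.

Lemma abs_zero_unif : abs_zero R (('X : {poly F})%:F) = q^-1.
Proof.
have := abs_zeroE 1 nX1 nX1; rewrite expr1z tofrac1 divr1 mulr1 => ->.
by rewrite exprN1.
Qed.

Lemma abs_zero_val (f : K) : f != 0 -> exists n : int, abs_zero R f = q ^ n.
Proof.
by move=> /zero_form[n [P [Q [nP nQ ->]]]]; exists (- n); exact: abs_zeroE.
Qed.

Lemma abs_zero_poly (P : {poly F}) : abs_zero R P%:F <= 1.
Proof.
have [->|P0] := eqVneq P 0; first by rewrite /abs_zero tofrac0 eqxx ler01.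
have [n [P' [nP ->]]] := X_factor P0.
have := abs_zeroE n nP nX1; rewrite tofrac1 divr1 rmorphM rmorphXn /= => ->.
by rewrite -exprnN invf_le1 ?exprn_gt0 ?(q_gt0 R)// exprn_ege1// ltW ?(q_gt1 R).
Qed.

Lemma abs_zero_res (f : K) : abs_zero R f <= 1 ->
  exists c : F, abs_zero R (f - c%:P%:F) < 1.
Proof.
have [->|f0] := eqVneq f 0.
  by move=> _; exists 0; rewrite polyC0 tofrac0 subr0 /abs_zero eqxx ltr01.
have [n [P [Q [nP nQ e]]]] := zero_form f0.
rewrite e abs_zeroE// -[leRHS](expr0z q) ler_eXz2l ?(q_gt1 R)// => n0.
have [n1|n1] := ltrP 0 n.
  exists 0; rewrite polyC0 tofrac0 subr0 abs_zeroE// -[ltRHS](expr0z q).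
  by rewrite ltr_eXz2l ?(q_gt1 R)//; lia.
have en : n = 0 by lia.
rewrite en expr0z mul1r.
have Q00 : Q.[0] != 0.
  by move: nQ; rewrite -['X]subr0 dvdp_XsubCl.
pose c := P.[0] / Q.[0]; exists c.
have Q0 : Q%:F != 0 by rewrite tofrac_eq0 X_ndvd0.
have -> : P%:F / Q%:F - c%:P%:F = (P - c%:P * Q)%:F / Q%:F.
  by rewrite tofracB tofracM mulrBl mulfK.
have [->|D0] := eqVneq (P - c%:P * Q) 0.
  by rewrite /abs_zero tofrac0 mul0r eqxx ltr01.
have [m [D' [nD eD]]] := X_factor D0.
rewrite eD tofracM tofracXn -mulrA exprnP abs_zeroE// -[ltRHS](expr0z q).
rewrite ltr_eXz2l ?(q_gt1 R)//.
case: m eD => [|m _]; last by lia.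
rewrite expr0 mul1r => eD; case/negP: nD; rewrite -eD -['X]subr0 dvdp_XsubCl.
by rewrite /root !hornerE divfK ?subrr.
Qed.

Lemma val_inftyE (P Q : {poly F}) : P != 0 -> Q != 0 ->
  val_infty (P%:F / Q%:F) = (size Q)%:Z - (size P)%:Z.
Proof.
move=> P0 Q0; apply: xget_unique; first by exists P, Q.
move=> m [P' [Q' [P0' Q0' e ->]]].
have : P * Q' = P' * Q.
  apply/eqP; rewrite -tofrac_eq !rmorphM /= -[_ * Q%:F]mul1r; apply/eqP.
  by apply: frac_cross; rewrite ?tofrac_eq0 ?mul1r.
move=> /(congr1 (fun p : {poly F} => size p)); rewrite !size_mul// => h.
have sz (p : {poly F}) : p != 0 -> (0 < size p)%N by rewrite size_poly_gt0.
have := sz _ P0; have := sz _ Q0; have := sz _ P0'; have := sz _ Q0'.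
by move: h; move: (size P) (size Q) (size P') (size Q') => a b c d; lia.
Qed.

Lemma abs_inftyE (P Q : {poly F}) : P != 0 -> Q != 0 ->
  abs_infty R (P%:F / Q%:F) = q ^ ((size P)%:Z - (size Q)%:Z).
Proof.
move=> P0 Q0; rewrite /abs_infty val_inftyE// opprB.
by rewrite mulf_eq0 invr_eq0 !tofrac_eq0 (negPf P0) (negPf Q0).
Qed.

Lemma abs_infty_poly (P : {poly F}) : P != 0 -> abs_infty R P%:F = q ^+ (size P).-1.
Proof.
move=> P0; have := abs_inftyE P0 (oner_neq0 _); rewrite tofrac1 divr1 => ->.
by rewrite size_poly1 exprnP; congr (_ ^ _); have := size_poly_gt0 P; rewrite P0; lia.
Qed.

Lemma abs_infty_unif : abs_infty R (('X : {poly F})%:F^-1) = q^-1.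
Proof.
have := abs_inftyE (oner_neq0 _) (negbT (polyX_eq0 F)); rewrite tofrac1 div1r => ->.
by rewrite size_poly1 size_polyX -exprN1.
Qed.

Lemma abs_infty_val (f : K) : f != 0 -> exists n : int, abs_infty R f = q ^ n.
Proof.
have [P [Q [Q0 ->]]] := fracP f; rewrite mulf_eq0 invr_eq0 !tofrac_eq0 (negPf Q0) orbF.
by move=> P0; exists ((size P)%:Z - (size Q)%:Z); exact: abs_inftyE.
Qed.

Lemma abs_infty_res (f : K) : abs_infty R f <= 1 ->
  exists c : F, abs_infty R (f - c%:P%:F) < 1.
Proof.
have [->|] := eqVneq f 0.
  by move=> _; exists 0; rewrite polyC0 tofrac0 subr0 /abs_infty eqxx ltr01.
have [P [Q [Q0 ->]]] := fracP f; rewrite mulf_eq0 invr_eq0 !tofrac_eq0 (negPf Q0) orbF.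
move=> P0; rewrite abs_inftyE// -[leRHS](expr0z q) ler_eXz2l ?(q_gt1 R)// => le.
pose c := P`_(size Q).-1 / lead_coef Q; exists c.
have Q0' : Q%:F != 0 by rewrite tofrac_eq0.
have -> : P%:F / Q%:F - c%:P%:F = (P - c%:P * Q)%:F / Q%:F.
  by rewrite tofracB tofracM mulrBl mulfK.
have [->|D0] := eqVneq (P - c%:P * Q) 0.
  by rewrite /abs_infty tofrac0 mul0r eqxx ltr01.
rewrite abs_inftyE// -[ltRHS](expr0z q) ltr_eXz2l ?(q_gt1 R)//.
have Qs : (0 < size Q)%N by rewrite size_poly_gt0.
suff : (size (P - c%:P * Q)%R <= (size Q).-1)%N by lia.
apply/leq_sizeP => j; rewrite leq_eqVlt => /predU1P[<-|lt].
  by rewrite coefB coefCM -lead_coefE divfK ?lead_coef_eq0 ?subrr.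
have sQ : (size Q <= j)%N by rewrite -(prednK Qs).
rewrite coefB coefCM [Q`_j]nth_default// mulr0 subr0 nth_default//.
by move: le; rewrite subr_le0 lez_nat => /leq_trans; apply.
Qed.

Definition const_frac : {rmorphism F -> K} := (@FracField.tofrac {poly F}) \o polyC.

Lemma zero_place (K0 : completion (@abs_zero R F)) :
  place (@compl_abs _ _ _ K0) (fun c => compl_emb K0 (const_frac c)) (compl_emb K0 'X%:F).
Proof.
apply: (completion_place (iota := const_frac)).
- exact: abs_zero_val.
- exact: abs_zero_unif.
- exact: abs_zero_res.
Qed.

Lemma infty_place (Kinf : completion (@abs_infty R F)) :
  place (@compl_abs _ _ _ Kinf) (fun c => compl_emb Kinf (const_frac c)) (compl_emb Kinf 'X%:F^-1).
Proof.
apply: (completion_place (iota := const_frac)).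
- exact: abs_infty_val.
- exact: abs_infty_unif.
- exact: abs_infty_res.
Qed.

End RationalFunctions.

(** * From weighted sphere sums to radial rapid decay *)

Section Schur.
Variables (R : realType) (G : groupType).
Local Notation nrm := ComplexField.Normc.normc.

Lemma normc_ge0 (z : R[i]) : 0 <= nrm z.
Proof. by case: z => x y; exact: sqrtr_ge0. Qed.

Lemma normc_sum (I : Type) (s : seq I) (F : I -> R[i]) :
  nrm (\sum_(i <- s) F i) <= \sum_(i <- s) nrm (F i).
Proof.
elim: s => [|i s IH]; first by rewrite !big_nil ComplexField.Normc.normc0.
rewrite !big_cons; apply: le_trans (le_normcD _ _) _.
by rewrite lerD2l.
Qed.

Lemma in_fsetP (T : choiceType) (A : set T) x : finite_set A ->
  (x \in fset_set A) <-> A x.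
Proof. by move=> fA; rewrite in_fset_set// in_setE. Qed.

(** Summing the inequality 2 t x <= t^2 p + x^2 / p with weights [a] gives a bound
    for every [t]; the choice t = (sum of a x) / P yields the result. *)
Lemma weighted_cauchy_schwarz (I : Type) (s : seq I) (a x p : I -> R) (P : R) :
  (forall i, 0 <= a i) -> (forall i, 0 < p i) -> 0 < P ->
  \sum_(i <- s) a i * p i <= P ->
  (\sum_(i <- s) a i * x i) ^+ 2 <= P * \sum_(i <- s) a i * (x i ^+ 2 / p i).
Proof.
move=> a0 p0 P0; set A := \sum_(i <- s) _ => AP.
set S := \sum_(i <- s) _; set Q := \sum_(i <- s) _.
have h (t : R) : 2 * t * S <= t ^+ 2 * A + Q.
  rewrite /S /A /Q !mulr_sumr -big_split /=; apply: ler_sum => i _.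
  rewrite !(mulrCA _ (a i)) -mulrDr; apply: ler_wpM2l => //.
  have := sqr_ge0 (t * p i - x i); rewrite -(pmulr_lge0 _ (_ : 0 < (p i)^-1)) ?invr_gt0// -subr_ge0.
  congr (_ <= _); field; exact: lt0r_neq0.
have := h (S / P); have : (S / P) ^+ 2 * A <= (S / P) ^+ 2 * P by rewrite ler_wpM2l ?sqr_ge0.
have -> : (S / P) ^+ 2 * P = S ^+ 2 / P by field; exact: lt0r_neq0.
have -> : 2 * (S / P) * S = 2 * (S ^+ 2 / P) by ring.
by move=> *; rewrite mulrC -ler_pdivrMr//; lra.
Qed.

Lemma sum_subseq (I : eqType) (s t : seq I) (F : I -> R) :
  uniq s -> uniq t -> {subset s <= t} -> (forall i, 0 <= F i) ->
  \sum_(i <- s) F i <= \sum_(i <- t) F i.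
Proof.
move=> us ut st F0; rewrite [leRHS](bigID (mem s)) /= -[X in _ <= X + _]big_filter.
rewrite [X in _ <= X + _](perm_big s) /=; last first.
  apply: uniq_perm => //; first exact: filter_uniq.
  by move=> i; rewrite mem_filter andb_idr//; exact: st.
by rewrite lerDl; apply: sumr_ge0.
Qed.

Lemma conv_finite (f xi : G -> R[i]) g : finite_set (supp f) ->
  conv f xi g = \sum_(h <- fset_set (supp f)) f h * xi (h^-1 * g)%g.
Proof.
move=> ff; apply: fsbigTE => h; rewrite in_fset_set// notin_setE /supp /=.
by move/contrapT => ->; rewrite mul0r.
Qed.

Lemma l2norm_le1 (xi : G -> R[i]) (Y : seq G) : uniq Y -> (l2norm xi <= 1)%E ->
  \sum_(g <- Y) nrm (xi g) ^+ 2 <= 1.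
Proof.
move=> uY; have -> : 1%E = sqrte 1%:E :> \bar R by rewrite /= sqrtr1.
rewrite lee_sqrt; last by rewrite lee_fin ler01.
move=> h; rewrite -lee_fin; apply: le_trans h.
apply: esum_ge; exists [set` Y]; first by split => //; exact: finite_seq.
by rewrite fsbig_seq//= -fsumEFin //; exact: finite_seq.
Qed.

(** Schur's test: the kernel [|f (g k^-1)|] is symmetric by the hypothesis on
    inverses, so a single positive weight [psi] controls both its rows and its
    columns. *)
Lemma schur_test (f : G -> R[i]) (psi : G -> R) (C : R) :
  finite_set (supp f) -> (forall h, nrm (f h^-1%g) = nrm (f h)) ->
  (forall g, 0 < psi g) -> 0 < C ->
  (forall g, \sum_(h <- fset_set (supp f)) nrm (f h) * psi (h^-1 * g)%g <= C * psi g) ->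
  (opnorm f <= C%:E)%E.
Proof.
move=> ff fV psi0 C0 hC; set A := fset_set (supp f).
have AV h : (h^-1%g \in A) = (h \in A).
  have e k : (k \in A) = (nrm (f k) != 0).
    rewrite in_fset_set//; apply/idP/idP; rewrite inE /supp /=.
      by move=> fk; apply/eqP => /ComplexField.Normc.eq0_normc.
    by move=> + fk; rewrite fk ComplexField.Normc.normc0 eqxx.
  by rewrite !e fV.
have hCV g : \sum_(h <- A) nrm (f h) * psi (h * g)%g <= C * psi g.
  apply: le_trans (hC g); rewrite -/A (perm_big [seq h^-1%g | h <- A]) /=; last first.
    apply: uniq_perm; rewrite ?fset_uniq//.
      by rewrite map_inj_uniq ?fset_uniq//; exact: invg_inj.
    move=> h; apply/idP/mapP => [hA|[k kA ->]]; last by rewrite AV.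
    by exists h^-1%g; rewrite ?AV ?invgK.
  by rewrite big_map; under eq_bigr => h _ do rewrite fV.
apply: ge_ereal_sup => _ [xi /= xi1 <-].
have -> : C%:E = sqrte (C ^+ 2)%:E by rewrite /= sqrtr_sqr gtr0_norm.
rewrite lee_sqrt; last by rewrite lee_fin sqr_ge0.
apply: ge_ereal_sup => _ [X [fX _] <-].
rewrite fsumEFin// lee_fin fsbig_finite//=; set X' := fset_set X.
(* [W h k] is the contribution of [f h] and [xi k] to the bound of the square
   of [conv f xi] at [h * k] *)
pose W h g := C * psi (h * g)%g * (nrm (f h) * (nrm (xi g) ^+ 2 / psi g)).
have W0 h g : 0 <= W h g.
  by rewrite !mulr_ge0 ?invr_ge0 ?sqr_ge0 ?normc_ge0 ?(ltW C0) ?(ltW (psi0 _)).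
apply: (@le_trans _ _ (\sum_(g <- X') \sum_(h <- A) W h (h^-1 * g)%g)).
  apply: ler_sum => g _; rewrite conv_finite// -/A.
  apply: (@le_trans _ _ ((\sum_(h <- A) nrm (f h) * nrm (xi (h^-1 * g)%g)) ^+ 2)).
    rewrite lerXn2r ?nnegrE ?normc_ge0 ?sumr_ge0//.
      by move=> h _; rewrite mulr_ge0 ?normc_ge0.
    apply: le_trans (normc_sum _ _) _; apply: ler_sum => h _.
    by rewrite ComplexField.Normc.normcM.
  have := weighted_cauchy_schwarz (fun h => nrm (xi (h^-1 * g)%g))
    (fun h => normc_ge0 (f h)) (fun h => psi0 (h^-1 * g)%g) (mulr_gt0 C0 (psi0 g)) (hC g).
  move/le_trans; apply; rewrite -/A mulr_sumr; apply: ler_sum => h _.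
  by rewrite /W mulVKg.
rewrite exchange_big /=.
set Y := undup [seq (h^-1 * g)%g | h <- A, g <- X'].
apply: (@le_trans _ _ (\sum_(h <- A) \sum_(g <- Y) W h g)).
  rewrite big_seq [leRHS]big_seq; apply: ler_sum => h hA.
  rewrite -(big_map (fun g => (h^-1 * g)%g) xpredT (W h)).
  apply: sum_subseq; rewrite ?undup_uniq//.
    by rewrite map_inj_uniq ?fset_uniq//; exact: mulgI.
  move=> k /mapP[g gX ->]; rewrite mem_undup; apply/allpairsP.
  by exists (h, g).
rewrite exchange_big /=.
apply: (@le_trans _ _ (\sum_(g <- Y) C ^+ 2 * nrm (xi g) ^+ 2)).
  apply: ler_sum => g _.
  have -> : \sum_(h <- A) W h g = C * (nrm (xi g) ^+ 2 / psi g) *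
      \sum_(h <- A) nrm (f h) * psi (h * g)%g.
    by rewrite mulr_sumr; apply: eq_bigr => h _; rewrite /W; ring.
  apply: le_trans (ler_wpM2l _ (hCV g)) _.
    by rewrite !mulr_ge0 ?invr_ge0 ?sqr_ge0 ?normc_ge0 ?(ltW C0) ?(ltW (psi0 _)).
  by rewrite le_eqVlt; apply/orP; left; apply/eqP; field; exact: lt0r_neq0.
rewrite -mulr_sumr -[leRHS]mulr1 ler_wpM2l ?sqr_ge0//.
by apply: l2norm_le1 => //; exact: undup_uniq.
Qed.

Lemma l2norm_finite (f : G -> R[i]) : finite_set (supp f) ->
  l2norm f = (Num.sqrt (\sum_(h <- fset_set (supp f)) nrm (f h) ^+ 2))%:E.
Proof.
move=> ff; rewrite /l2norm.
rewrite (_ : esum _ _ = (\sum_(h <- fset_set (supp f)) nrm (f h) ^+ 2)%:E)//.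
rewrite -fsbig_finite//= -fsumEFin// -esum_fset//; last first.
  by move=> i _; rewrite lee_fin sqr_ge0.
rewrite [RHS]esum_mkcond; apply: eq_esum => g _.
case: ifPn => //; rewrite notin_setE /supp /= => /contrapT ->.
by rewrite ComplexField.Normc.normc0 expr0n.
Qed.

(** For radial [f], the value of |f| on the sphere of radius [n] times the square
    root of its cardinality is the l2 norm of the restriction of [f] to that
    sphere, hence at most the l2 norm of [f]. Each of the at most [L(f) + 1]
    spheres thus contributes D (L(f) + 1)^3 times that norm to Schur's test, so
    that the polynomial D (X + 1)^4 suits. *)
Lemma RRD_of_spheres (len : G -> nat) (psi : G -> R) (D : R) :
  proper_length (fun g => (len g)%:R : R) ->
  (forall g, 0 < psi g) -> 0 < D ->
  (forall n g, \sum_(h <- fset_set [set h | len h = n]) psi (h^-1 * g)%g <=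
     D * n.+1%:R ^+ 3 * Num.sqrt #|` fset_set [set h | len h = n]|%:R * psi g) ->
  RRD (fun g => (len g)%:R : R).
Proof.
move=> pL psi0 D0 hD; split => //.
exists (D *: ('X + 1%:P) ^+ 4) => f ff [h0 fh0] rf.
set ell := fun_length _ _.
have ell0 : 0 <= ell by exact: bigmax_ge_id.
have len_ell h : supp f h -> (len h)%:R <= ell.
  move=> fh; have [->//|lh] := eqVneq (len h) 0%N.
  rewrite /ell /fun_length.
  apply: (le_bigmax_seq 0 h xpredT (fun g => (len g)%:R : R)) => //.
  rewrite in_finite_support; last exact: finite_setIl.
  by rewrite inE; split=> //=; apply/eqP; rewrite pnatr_eq0.
rewrite l2norm_finite//; set A := fset_set (supp f).
set N2 := Num.sqrt _; have N20 : 0 < N2.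
  rewrite sqrtr_gt0 (big_fsetD1 h0) /=; last by rewrite in_fset_set// inE.
  rewrite ltr_wpDr ?sumr_ge0// => [i _|]; first exact: sqr_ge0.
  rewrite exprn_gt0// lt_def normc_ge0 andbT; apply/eqP => /ComplexField.Normc.eq0_normc.
  exact: fh0.
rewrite hornerZ horner_exp hornerD hornerX hornerC -EFinM.
have fin n : finite_set [set h | len h = n].
  apply: sub_finite_set (finite_balls pL n%:R) => h /= ->.
  exact: lexx.
have fV h : nrm (f h^-1%g) = nrm (f h) by congr nrm; apply: rf; exact: (lengthV pL).
apply: (schur_test ff fV psi0); first by rewrite !mulr_gt0 ?exprn_gt0 ?ltr_wpDl ?ltr01.
move=> g; set N := Num.truncn ell.
have lenN h : h \in A -> (len h < N.+1)%N.
  by rewrite in_fset_set// inE => /len_ell; rewrite ltnS truncn_ge_nat.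
have sphere n : \sum_(h <- A | len h == n) nrm (f h) * psi (h^-1 * g)%g <=
    D * n.+1%:R ^+ 3 * N2 * psi g.
  have [/hasP[k kA /eqP kn]|/hasPn nA] := boolP (has (fun h => len h == n) A); last first.
    rewrite big_seq_cond big1 ?mulr_ge0 ?exprn_ge0 ?(ltW D0) ?(ltW N20) ?(ltW (psi0 _))//.
    by move=> h /andP[/nA /negPf ->].
  set S := fset_set [set h | len h = n].
  have fk h : len h = n -> f h = f k by move=> hn; apply: rf; rewrite hn kn.
  have SA h : (h \in S) = (h \in A) && (len h == n).
    apply/idP/andP => [/(in_fsetP _ (fin n)) hn|[_ /eqP hn]]; last exact/(in_fsetP _ (fin n)).
    split; last exact/eqP.
    by apply/(in_fsetP _ ff); rewrite /supp /= (fk _ hn); exact/(in_fsetP _ ff).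
  have pS : perm_eq [seq h <- A | len h == n] S.
    apply: uniq_perm; rewrite ?filter_uniq ?fset_uniq// => h.
    by rewrite mem_filter SA andbC.
  rewrite -big_filter (perm_big _ pS) /=.
  have -> : \sum_(h <- S) nrm (f h) * psi (h^-1 * g)%g = nrm (f k) * \sum_(h <- S) psi (h^-1 * g)%g.
    rewrite mulr_sumr big_seq [RHS]big_seq; apply: eq_bigr => h.
    by rewrite SA => /andP[_ /eqP /fk ->].
  apply: le_trans (ler_wpM2l (normc_ge0 _) (hD n g)) _; rewrite -/S.
  have -> : nrm (f k) * (D * n.+1%:R ^+ 3 * Num.sqrt #|` S|%:R * psi g) =
     D * n.+1%:R ^+ 3 * (nrm (f k) * Num.sqrt #|` S|%:R) * psi g by ring.
  rewrite ler_wpM2r ?(ltW (psi0 _))// ler_wpM2l ?mulr_ge0 ?exprn_ge0 ?(ltW D0)//.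
  rewrite -[nrm (f k)]ger0_norm ?normc_ge0// -sqrtr_sqr -sqrtrM ?sqr_ge0//.
  rewrite ler_sqrt; last by apply: sumr_ge0 => h _; exact: sqr_ge0.
  have -> : nrm (f k) ^+ 2 * #|` S|%:R = \sum_(h <- S) nrm (f h) ^+ 2.
    rewrite big_seq (eq_bigr (fun=> nrm (f k) ^+ 2)) => [|h]; last first.
      by rewrite SA => /andP[_ /eqP /fk ->].
    by rewrite -big_seq big_const_seq count_predT iter_addr_0 mulr_natr.
  apply: sum_subseq; rewrite ?fset_uniq// => h; last exact: sqr_ge0.
  by rewrite SA => /andP[].
apply: (@le_trans _ _ (\sum_(n < N.+1) \sum_(h <- A | len h == n) nrm (f h) * psi (h^-1 * g)%g)).
  rewrite (exchange_big_dep xpredT)//= big_seq [leRHS]big_seq; apply: ler_sum => h hA.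
  by rewrite (big_pred1 (Ordinal (lenN _ hA)))// => n; rewrite /= eq_sym.
apply: le_trans (ler_sum _ (fun (n : 'I_N.+1) _ => sphere n)) _.
have NL : N.+1%:R <= ell + 1 by rewrite -natr1 lerD2r -truncn_ge_nat.
apply: (@le_trans _ _ (\sum_(n < N.+1) D * (ell + 1) ^+ 3 * N2 * psi g)).
  apply: ler_sum => n _; rewrite !ler_wpM2r ?(ltW (psi0 _)) ?(ltW N20)//.
  rewrite ler_wpM2l ?(ltW D0)// lerXn2r ?nnegrE ?addr_ge0//.
  by apply: le_trans NL; rewrite ler_nat ltn_ord.
rewrite sumr_const card_ord -mulr_natr.
have -> : D * (ell + 1) ^+ 3 * N2 * psi g * N.+1%:R =
    N.+1%:R * (D * (ell + 1) ^+ 3 * N2 * psi g) by ring.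
have -> : D * (ell + 1) ^+ 4 * N2 * psi g = (ell + 1) * (D * (ell + 1) ^+ 3 * N2 * psi g) by ring.
apply: ler_wpM2r => //.
by rewrite !mulr_ge0 ?exprn_ge0 ?addr_ge0 ?(ltW D0) ?(ltW N20) ?(ltW (psi0 _)).
Qed.

End Schur.

(** * Groups acting on a product of two trees *)

Section SphereSums.
Variables (R : realType) (F : finFieldType) (G : groupType).

Local Notation q := (#|F|%:R : R).

(** Each nonempty fibre of [f] is contained in a left translate of [S]. *)
Lemma sum_fibers (T : finType) (S : seq G) (s : seq G) (f : G -> T) : uniq s ->
  (forall x y, x \in s -> y \in s -> f x = f y -> (x^-1 * y)%g \in S) ->
  (size s <= size S * #|T|)%N.
Proof.
move=> us h; have -> : size s = (\sum_(t : T) count (fun x => f x == t) s)%N.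
  rewrite -sum1_size (partition_big f xpredT)//=; apply: eq_bigr => t _.
  by rewrite sum1_count.
have bnd (t : T) : true -> (count (fun x => f x == t) s <= size S)%N.
  move=> _; rewrite -size_filter.
  have [->//|[x]] : [seq x <- s | f x == t] = [::] \/ exists x, x \in [seq x <- s | f x == t].
    by case: [seq x <- s | f x == t] => [|x r]; [left | right; exists x; rewrite mem_head].
  rewrite mem_filter => /andP[/eqP fx xs].
  rewrite -(size_map (fun y => (x^-1 * y)%g)); apply: uniq_leq_size.
    by rewrite map_inj_uniq ?filter_uniq//; exact: mulgI.
  by move=> _ /mapP[y + ->]; rewrite mem_filter => /andP[/eqP fy ys]; apply: h; rewrite // fx.
by apply: leq_trans (leq_sum _ bnd) _; rewrite sum_nat_const mulnC.
Qed.

Section OneTree.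
Variables (K : fieldType) (ab : K -> R) (iota : F -> K) (pi : K) (pl : place ab iota pi).
Variables (phi : G -> SL 2 K) (phiM : forall g h, phi (g * h)%g = (phi g * phi h)%g).
Variable v : vertex ab.

Definition disp g := tree_dist v (act (phi g) v).

Lemma act_phiM g h (w : vertex ab) : act (phi (g * h)%g) w = act (phi g) (act (phi h) w).
Proof. by rewrite phiM (actM pl). Qed.

Lemma phi_one : phi 1%g = 1%g.
Proof. by apply: (mulgI (phi 1%g)); rewrite -phiM !mulg1. Qed.

Lemma act_phi1 (w : vertex ab) : act (phi 1%g) w = w.
Proof. by rewrite phi_one (act1 pl). Qed.

Lemma disp_moved g h : tree_dist (act (phi g) v) (act (phi (g * h)%g) v) = disp h.
Proof. by rewrite act_phiM (act_dist pl). Qed.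

Lemma disp1 : disp 1%g = 0%N.
Proof. by rewrite /disp act_phi1; apply/(tree_dist_eq0 pl). Qed.

Lemma dispV g : disp g^-1%g = disp g.
Proof. by rewrite -(disp_moved g) mulgV act_phi1 (tree_distC pl). Qed.

Lemma dispM g h : (disp (g * h)%g <= disp g + disp h)%N.
Proof. by rewrite -(disp_moved g h); exact: (tree_dist_tri pl). Qed.

Lemma disp_eq0 g h : act (phi g) v = act (phi h) v -> disp (g^-1 * h)%g = 0%N.
Proof.
by move=> e; apply/(tree_dist_eq0 pl); rewrite act_phiM -e -act_phiM mulVg act_phi1.
Qed.

End OneTree.

Variables (K1 : fieldType) (ab1 : K1 -> R) (iota1 : F -> K1) (pi1 : K1).
Variables (K2 : fieldType) (ab2 : K2 -> R) (iota2 : F -> K2) (pi2 : K2).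
Variables (pl1 : place ab1 iota1 pi1) (pl2 : place ab2 iota2 pi2).
Variables (phi1 : G -> SL 2 K1) (phi2 : G -> SL 2 K2).
Hypothesis phi1M : forall g h, phi1 (g * h)%g = (phi1 g * phi1 h)%g.
Hypothesis phi2M : forall g h, phi2 (g * h)%g = (phi2 g * phi2 h)%g.
Variables (v1 : vertex ab1) (v2 : vertex ab2).

Definition len g := (disp phi1 v1 g + disp phi2 v2 g)%N.

Lemma proper_len : (forall n, finite_set [set g | (len g <= n)%N]) ->
  proper_length (fun g => (len g)%:R : R).
Proof.
move=> fb; split.
- by rewrite /len (disp1 pl1 phi1M) (disp1 pl2 phi2M).
- by move=> g; rewrite /len (dispV pl1 phi1M) (dispV pl2 phi2M).
- move=> g h; rewrite -natrD ler_nat /len addnACA.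
  by rewrite leq_add ?(dispM pl1 phi1M) ?(dispM pl2 phi2M).
- move=> r; apply: sub_finite_set (fb (Num.truncn r)) => g /= gr.
  by rewrite truncn_ge_nat// (le_trans _ gr).
Qed.

(** Up to a constant factor, the square root of the Poisson kernel of the product
    of the trees at the pair of ends that defines [rho]. The inverse is there
    because [conv] translates on the left. *)
Definition poisson g : R :=
  Num.sqrt (rho (act (phi1 g^-1%g) v1) * rho (act (phi2 g^-1%g) v2)).

Lemma poisson_gt0 g : 0 < poisson g.
Proof. by rewrite sqrtr_gt0 mulr_gt0 ?(rho_gt0 pl1) ?(rho_gt0 pl2). Qed.

Let q0 := q_gt0 R F.

(** On the part of the sphere where the displacements are [l] and [n - l] and the
    geodesics climb [j] and [j'] steps, at most q^(n - j - j') pairs of vertices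
    are reached, each by at most as many elements as the stabilizer has, and the weight
    is multiplied by q^(j + j' - n/2). Each part thus contributes at most the same
    amount, and there are at most (n + 1)^3 parts. *)
Lemma sphere_sum n g : finite_set [set h | len h = n] -> finite_set [set h | len h = 0%N] ->
  \sum_(h <- fset_set [set h | len h = n]) poisson (h^-1 * g)%g <=
  #|` fset_set [set h | len h = 0%N]|%:R * n.+1%:R ^+ 3 * Num.sqrt q ^+ n * poisson g.
Proof.
move=> fn f0; set S := fset_set _; set St := fset_set _.
pose x := act (phi1 g^-1%g) v1; pose y := act (phi2 g^-1%g) v2.
pose x' h := act (phi1 (g^-1 * h)%g) v1; pose y' h := act (phi2 (g^-1 * h)%g) v2.
have dx h : tree_dist x (x' h) = disp phi1 v1 h by exact: (disp_moved pl1 phi1M).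
have dy h : tree_dist y (y' h) = disp phi2 v2 h by exact: (disp_moved pl2 phi2M).
pose jx h := horo_index pl1 x (x' h); pose jy h := horo_index pl2 y (y' h).
have jxl h : (jx h <= disp phi1 v1 h)%N by rewrite -dx horo_index_le.
have jyl h : (jy h <= disp phi2 v2 h)%N by rewrite -dy horo_index_le.
have Sn h : h \in S -> (disp phi1 v1 h + disp phi2 v2 h)%N = n by move/(in_fsetP _ fn).
pose cl h : 'I_n.+1 * 'I_n.+1 * 'I_n.+1 :=
  (inord (disp phi1 v1 h), inord (jx h), inord (jy h)).
have clP h l j j' : h \in S -> cl h = (l, j, j') ->
    [/\ disp phi1 v1 h = l, disp phi2 v2 h = (n - l)%N, jx h = j & jy h = j'].
  move=> hS [<- <- <-]; have := Sn _ hS; have := jxl h; have := jyl h.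
  move: (disp _ _ h) (disp _ _ h) (jx h) (jy h) => a b c d cb ca ab.
  have [an cn dn] : [/\ (a < n.+1)%N, (d < n.+1)%N & (c < n.+1)%N] by split; lia.
  by rewrite !inordK//; split=> //; lia.
have sq0 : 0 < Num.sqrt q ^+ n by rewrite exprn_gt0 ?sqrtr_gt0.
have sqq : Num.sqrt q ^+ n * Num.sqrt q ^+ n = q ^+ n.
  by rewrite -exprMn -expr2 sqr_sqrtr ?(ltW q0).
have weight h : h \in S ->
    poisson (h^-1 * g)%g * Num.sqrt q ^+ n = poisson g * q ^+ (jx h + jy h).
  move=> /Sn hn; rewrite -[RHS]ger0_norm ?mulr_ge0 ?sqrtr_ge0 ?exprn_ge0 ?(ltW q0)//.
  rewrite -[LHS]ger0_norm ?mulr_ge0 ?sqrtr_ge0 ?exprn_ge0 ?sqrtr_ge0//.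
  rewrite -!sqrtr_sqr; congr Num.sqrt.
  rewrite !exprMn !sqr_sqrtr ?mulr_ge0 ?(ltW (rho_gt0 pl1 _)) ?(ltW (rho_gt0 pl2 _))//.
  rewrite invgM invgK -/x -/y -/(x' h) -/(y' h) [(_ ^+ n) ^+ 2]expr2 sqq -hn exprD.
  have e1 := rho_horo pl1 x (x' h); have e2 := rho_horo pl2 y (y' h).
  rewrite dx -/(jx h) in e1; rewrite dy -/(jy h) in e2.
  rewrite mulrACA e1 e2 mulrACA -exprD -doubleD -mul2n exprM.
  by rewrite -!exprM mulnC.
have part c : \sum_(h <- S | cl h == c) poisson (h^-1 * g)%g <=
    #|` St|%:R * Num.sqrt q ^+ n * poisson g.
  case: c => [[l j] j']; rewrite -big_filter; set s := [seq _ <- _ | _].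
  have sS h : h \in s -> h \in S /\ cl h = (l, j, j').
    by rewrite mem_filter => /andP[/eqP].
  have [->|[k ks]] : s = [::] \/ exists k, k \in s.
      by case: s {sS} => [|k r]; [left | right; exists k; rewrite mem_head].
    by rewrite big_nil !mulr_ge0 ?exprn_ge0 ?sqrtr_ge0.
  have [kS /(clP _ _ _ _ kS)[kl kl' kj kj']] := sS _ ks.
  have jl : (j <= l)%N by rewrite -kl -kj.
  have jl' : (j' <= n - l)%N by rewrite -kl' -kj'.
  have ln : (l <= n)%N by rewrite -ltnS.
  have val h : h \in s -> poisson (h^-1 * g)%g = poisson g * q ^+ (j + j') / Num.sqrt q ^+ n.
    move=> /sS[hS hc]; have [_ _ <- <-] := clP _ _ _ _ hS hc.
    by rewrite -weight// mulfK ?lt0r_neq0.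
  rewrite big_seq (eq_bigr _ val) -big_seq big_const_seq count_predT iter_addr_0.
  have sz : (size s <= #|` St| * #|{: (l - j).-tuple F * (n - l - j').-tuple F}|)%N.
    apply: (@sum_fibers _ _ _ (fun h =>
      (horo_code iota1 pi1 x l j (x' h), horo_code iota2 pi2 y (n - l) j' (y' h)))).
      by rewrite filter_uniq// fset_uniq.
    move=> a b /sS[aS /(clP _ _ _ _ aS)[al al' aj aj']].
    move=> /sS[bS /(clP _ _ _ _ bS)[bl bl' bj bj']] [e1 e2].
    have ex : x' a = x' b.
      apply: (horo_inj pl1 jl _ _ _ _ e1); rewrite ?dx//.
        by rewrite -al -aj -dx (rho_horo pl1).
      by rewrite -bl -bj -dx (rho_horo pl1).
    have ey : y' a = y' b.
      apply: (horo_inj pl2 jl' _ _ _ _ e2); rewrite ?dy//.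
        by rewrite -al' -aj' -dy (rho_horo pl2).
      by rewrite -bl' -bj' -dy (rho_horo pl2).
    apply/(in_fsetP _ f0); rewrite /= /len.
    have eV : (a^-1 * b = (g^-1 * a)^-1 * (g^-1 * b))%g by rewrite invgM invgK -mulgA mulVKg.
    by rewrite eV (disp_eq0 pl1 phi1M ex) (disp_eq0 pl2 phi2M ey).
  rewrite card_prod !card_tuple -expnD in sz.
  rewrite -[leLHS]mulr_natl; apply: (@le_trans _ _ ((#|` St| * #|F| ^ (l - j + (n - l - j')))%N%:R *
      (poisson g * q ^+ (j + j') / Num.sqrt q ^+ n))).
    rewrite ler_wpM2r ?ler_nat// !mulr_ge0 ?invr_ge0 ?exprn_ge0 ?sqrtr_ge0//.
  rewrite natrM natrX le_eqVlt; apply/orP; left; apply/eqP.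
  have eq : q ^+ (l - j + (n - l - j')) * q ^+ (j + j') = Num.sqrt q ^+ n * Num.sqrt q ^+ n.
    by rewrite sqq -exprD; congr (_ ^+ _); lia.
  apply: (mulIf (lt0r_neq0 sq0)); rewrite !mulrA divfK ?lt0r_neq0//.
  transitivity (#|` St|%:R * (q ^+ (l - j + (n - l - j')) * q ^+ (j + j')) * poisson g).
    by ring.
  by rewrite eq; ring.
rewrite (partition_big cl xpredT)//=.
apply: le_trans (ler_sum _ (fun c _ => part c)) _.
rewrite sumr_const !card_prod card_ord -[leLHS]mulr_natr !natrM.
by rewrite le_eqVlt; apply/orP; left; apply/eqP; ring.
Qed.

(** A nonempty sphere of radius [n] with at least a constant times q^n elements
    absorbs the factor q^(n/2) of [sphere_sum] into the square root of its
    cardinality. *)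
Lemma RRD_of_growth (c : R) : (forall n, finite_set [set g | (len g <= n)%N]) -> 0 < c ->
  (forall n h, len h = n -> q ^+ n <= c * #|` fset_set [set g | len g = n]|%:R) ->
  RRD (fun g => (len g)%:R : R).
Proof.
move=> fb c0 growth.
have fin n : finite_set [set g | len g = n].
  by apply: sub_finite_set (fb n) => h /= ->.
set St := fset_set [set h | len h = 0%N].
apply: (@RRD_of_spheres _ _ _ poisson (#|` St|%:R * Num.sqrt c)).
- exact: proper_len.
- exact: poisson_gt0.
- rewrite mulr_gt0 ?sqrtr_gt0// ltr0n cardfs_gt0; apply/fset0Pn; exists 1%g.
  apply/(in_fsetP _ (fin _)).
  by rewrite /= /len (disp1 pl1 phi1M) (disp1 pl2 phi2M).
move=> n g; have [[h hn]|none] := pselect (exists h, len h = n); last first.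
  rewrite [X in fset_set X](_ : _ = set0); last first.
    by apply/seteqP; split=> // h hn; apply: none; exists h.
  by rewrite fset_set0 big_seq_fset0 ?mulr_ge0 ?exprn_ge0 ?sqrtr_ge0.
apply: le_trans (sphere_sum g (fin n) (fin 0%N)) _; rewrite -/St.
rewrite ler_wpM2r ?(ltW (poisson_gt0 _))//.
set N := #|` fset_set [set h | len h = n]|; set M := (_ : R) ^+ 3.
have M0 : 0 <= M by rewrite exprn_ge0.
have : Num.sqrt q ^+ n <= Num.sqrt c * Num.sqrt N%:R.
  rewrite -sqrtrM ?(ltW c0)// -[leLHS]ger0_norm ?exprn_ge0 ?sqrtr_ge0//.
  rewrite -sqrtr_sqr -exprM mulnC exprM sqr_sqrtr ?(ltW q0)//.
  by rewrite ler_sqrt ?(growth _ h)// mulr_ge0 ?(ltW c0).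
move=> /(ler_wpM2l (mulr_ge0 (ler0n R #|` St|) M0)) /le_trans; apply.
by rewrite le_eqVlt; apply/orP; left; apply/eqP; ring.
Qed.

End SphereSums.

(** * Counting coprime pairs of polynomials *)

Section CoprimePairs.
Variable F : finFieldType.

Lemma gcd_factor (w z : {poly F}) : w \is monic -> exists g w1 z1 : {poly F},
  [/\ g \is monic, w = g * w1, z = g * z1 & coprimep w1 z1].
Proof.
move=> mw; have w0 := monic_neq0 mw; set d := gcdp w z.
have d0 : d != 0 by rewrite gcdp_eq0 negb_and w0.
have l0 : lead_coef d != 0 by rewrite lead_coef_eq0.
exists ((lead_coef d)^-1 *: d), (lead_coef d *: (w %/ d)), (lead_coef d *: (z %/ d)); split.
- by rewrite monicE lead_coefZ mulVf.
- by rewrite -scalerAr -scalerAl scalerA mulfV// scale1r mulrC divpK ?dvdp_gcdl.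
- by rewrite -scalerAr -scalerAl scalerA mulfV// scale1r mulrC divpK ?dvdp_gcdr.
- by rewrite coprimepZl// coprimepZr// coprimep_div_gcd// w0.
Qed.

Lemma gcd_factor_unique (g w z g' w' z' : {poly F}) :
  g \is monic -> g' \is monic -> coprimep w z -> coprimep w' z' ->
  g * w = g' * w' -> g * z = g' * z' -> [/\ g = g', w = w' & z = z'].
Proof.
move=> mg mg' c c' ew ez; have gg : g = g'.
  apply/eqP; rewrite -eqp_monic//.
  have h (a b e : {poly F}) : coprimep b e -> gcdp (a * b) (a * e) %= a.
    move=> be; apply: eqp_trans (gcdp_mul2l _ _ _) _.
    by rewrite -[X in _ %= X]mulr1 eqp_mull// gcdp_eqp1.
  by rewrite -(eqp_rtrans (h _ _ _ c')) -ew -ez eqp_sym h.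
by split=> //; [move: ew | move: ez]; rewrite gg; apply: mulfI; exact: monic_neq0.
Qed.

Definition monic_of m (a : 'rV[F]_m) : {poly F} := 'X^m + rVpoly a.

Lemma size_rVpoly m (a : 'rV[F]_m) : (size (rVpoly a) <= m)%N.
Proof. exact: size_poly. Qed.

Lemma size_monic_of m (a : 'rV[F]_m) : size (monic_of a) = m.+1.
Proof. by rewrite size_polyDl size_polyXn// ltnS size_rVpoly. Qed.

Lemma monic_of_monic m (a : 'rV[F]_m) : monic_of a \is monic.
Proof. by rewrite monicE lead_coefDl ?lead_coefXn// size_polyXn ltnS size_rVpoly. Qed.

Lemma monic_ofP m (p : {poly F}) : p \is monic -> size p = m.+1 ->
  exists a : 'rV[F]_m, monic_of a = p.
Proof.
move=> mp sp; exists (poly_rV (p - 'X^m)); rewrite /monic_of poly_rV_K.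
  by rewrite addrC subrK.
apply/leq_sizeP => j; rewrite leq_eqVlt coefB coefXn => /predU1P[<-|lt].
  by rewrite eqxx; move: mp; rewrite monicE lead_coefE sp /= => /eqP ->; rewrite subrr.
by rewrite nth_default ?sp// gtn_eqF// subrr.
Qed.

Lemma rVpoly_inj m : injective (@rVpoly F m).
Proof. exact: can_inj rVpolyK. Qed.

Definition coprime_pairs m : {set 'rV[F]_m * 'rV[F]_m} :=
  [set t | coprimep (monic_of t.1) (rVpoly t.2)].

(** Let [g] be the monic gcd of a pair that is not coprime, and write
    g = h X + g(0). The pair is determined by g(0) and by the pair in which the
    factor [g] is replaced by [h]: the gcd of the latter is [h]. Its degree is
    smaller by one, so at most a proportion 1/q of the pairs fail to be coprime. *)
Lemma card_coprime_pairs m : (#|F| ^ (m.+1 + m.+1) <= 2 * #|coprime_pairs m.+1|)%N.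
Proof.
pose T n := ('rV[F]_n * 'rV[F]_n)%type.
have cardT n : #|{: T n}| = (#|F| ^ (n + n))%N by rewrite card_prod !card_mx !mul1n expnD.
pose Q (t : T m.+1) (s : F * T m) := exists g w z : {poly F},
  [/\ g \is monic, coprimep w z,
      monic_of t.1 = (g * 'X + s.1%:P) * w, rVpoly t.2 = (g * 'X + s.1%:P) * z &
      monic_of s.2.1 = g * w /\ rVpoly s.2.2 = g * z].
have exQ (t : T m.+1) : exists s, t \notin coprime_pairs m.+1 -> Q t s.
  have [tc|nc] := boolP (t \in coprime_pairs m.+1); first by exists (0, (0, 0)).
  have [g [w [z [mg ew ez wz]]]] := gcd_factor (rVpoly t.2) (monic_of_monic t.1).
  have mw : w \is monic by have := monic_of_monic t.1; rewrite ew monicMl.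
  have g1 : (1 < size g)%N.
    rewrite ltnNge; apply: contra nc => g1; rewrite inE ew ez.
    suff -> : g = 1 by rewrite !mul1r.
    by apply/eqP; rewrite -eqp_monic ?monic1// -size_poly_eq1 eqn_leq g1 size_poly_gt0 monic_neq0.
  have [h eh] : exists h : {poly F}, g = h * 'X + g.[0]%:P.
    have : root (g - g.[0]%:P) 0 by rewrite /root !hornerE subrr.
    by move/factor_theorem => [h]; rewrite subr0 => e; exists h; rewrite -e subrK.
  have h0 : h != 0.
    apply: contraTneq g1 => h0; rewrite eh h0 mul0r add0r -leqNgt.
    exact: size_polyC_leq1.
  have sg : size g = (size h).+1 by rewrite {1}eh size_MXaddC (negPf h0).
  have mh : h \is monic.
    move: mg; rewrite !monicE {1}eh lead_coefDl ?lead_coefMX//.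
    by rewrite size_mulX// (leq_ltn_trans (size_polyC_leq1 _))// ltnS size_poly_gt0.
  have shw : size (h * w) = m.+1.
    have := size_monic_of t.1; rewrite ew !size_monicM ?monic_neq0//.
    by rewrite sg addSn /= => ->.
  have shz : (size (h * z)%R <= m)%N.
    have [->|z0] := eqVneq z 0; first by rewrite mulr0 size_poly0.
    have := size_rVpoly t.2; rewrite ez !size_monicM// sg addSn /=.
    have : (0 < size h)%N by rewrite size_poly_gt0.
    by case: (size h).
  have mhw : h * w \is monic by rewrite monicMl.
  have [a ea] := monic_ofP mhw shw.
  exists (g.[0], (a, poly_rV (h * z))) => _; exists h, w, z.
  by rewrite -eh ea poly_rV_K.
have [f hf] := choice exQ.
have injf : {in ~: coprime_pairs m.+1 &, injective f}.
  move=> t t'; rewrite !inE => nt nt' e.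
  have [|g [w [z [mg wz e1 e2 [e3 e4]]]]] := hf t; first by rewrite inE.
  have [|g' [w' [z' [mg' wz' e1' e2' [e3' e4']]]]] := hf t'; first by rewrite inE.
  rewrite -e in e1' e2' e3' e4'.
  have [eg ew ez] : [/\ g = g', w = w' & z = z'].
    by apply: gcd_factor_unique => //; [rewrite -e3 e3' | rewrite -e4 e4'].
  rewrite -eg -ew -ez -e1 -e2 in e1' e2'.
  case: t t' e1' e2' {nt nt' e e1 e2 e3 e4 e3' e4'} => [a b] [a' b'] /=.
  by move=> /addrI /rVpoly_inj -> /rVpoly_inj ->.
have le : (#|~: coprime_pairs m.+1| <= #|F| ^ (m + m).+1)%N.
  rewrite -(card_in_imset injf); apply: leq_trans (max_card _) _.
  by rewrite card_prod cardT expnS.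
have := cardsC (coprime_pairs m.+1); rewrite cardT => eT.
have q2 : (1 < #|F|)%N by exact: card_finNzRing_gt1.
have e2 : (#|F| ^ (m.+1 + m.+1) = #|F| * #|F| ^ (m + m).+1)%N by rewrite addSn addnS -expnS.
have : (2 * #|F| ^ (m + m).+1 <= #|F| ^ (m.+1 + m.+1))%N by rewrite e2 leq_mul2r q2 orbT.
by rewrite -eT; lia.
Qed.

(** A coprime pair is the last row of a matrix of determinant 1 whose first row
    consists of Bezout cofactors, of degree at most that of the pair. *)
Lemma bezout_sl2 m (w z : {poly F}) : size w = m.+2 -> (size z <= m.+1)%N -> coprimep w z ->
  exists M : 'M[{poly F}]_2, [/\ \det M = 1, M 1 0 = z, M 1 1 = w &
    forall i j, (size (M i j) <= m.+2)%N].
Proof.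
move=> sw sz wz; have w0 : w != 0 by rewrite -size_poly_gt0 sw.
have z0 : z != 0.
  by apply: contraTneq wz => ->; rewrite coprimep0 -size_poly_eq1 sw.
have [s1 s2 e] := egcdpP w0 z0; set u := egcdp w z in s1 s2 e.
have : u.1 * w + u.2 * z %= 1.
  by rewrite eqp_sym (eqp_trans _ e)// eqp_sym gcdp_eqp1.
rewrite -size_poly_eq1 => /size_poly1P[c c0 ec].
pose M : 'M[{poly F}]_2 := \matrix_(i, j) if i == 0
  then (if j == 0 then c^-1 *: u.1 else - (c^-1 *: u.2)) else (if j == 0 then z else w).
exists M; split; rewrite ?mxE//.
  rewrite det2 !mxE /= mulNr opprK -!scalerAl -scalerDr ec.
  by rewrite -mul_polyC -polyCM mulVf.
have ic : c^-1 != 0 by rewrite invr_eq0.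
have [b1 b2 b3] : [/\ (size u.1 <= m.+2)%N, (size u.2 <= m.+2)%N & (size z <= m.+2)%N].
  by split; [exact: leq_trans s1 (leqW sz) | rewrite -sw | exact: leqW].
by elim/ord2P; elim/ord2P; rewrite mxE /= ?size_polyN ?size_scale// sw.
Qed.

End CoprimePairs.

(** * The group SL2(F[X, 1/X]) *)

Section LaurentGroup.
Variables (R : realType) (F : finFieldType).

Local Notation K := {fraction {poly F}}.
Local Notation "x %:F" := (tofrac x).
Local Notation q := (#|F|%:R : R).
Local Notation G := (SL 2 (laurent F)).

Lemma q_cofinal (C : R) : exists N, C < q ^+ N.
Proof.
exists (Num.bound `|C|); apply: le_lt_trans (ler_norm C) _.
apply: lt_le_trans (archi_boundP (normr_ge0 C)) _; set N := Num.bound _.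
have q1 : 1 <= q - 1.
  by have : 2 <= q by [rewrite ler_nat card_finNzRing_gt1]; lra.
have := bernoulli N (le_trans ler01 q1); rewrite [1 + (q - 1)]addrC subrK.
by apply: le_trans; rewrite -[leLHS]add0r lerD// ler_peMr.
Qed.

Lemma laurentP (f : K) : reflect (exists P n, f = P%:F / 'X%:F ^+ n) (f \in @laurent_pred F).
Proof. exact: asboolP. Qed.

Lemma finite_poly_size N : finite_set [set P : {poly F} | (size P <= N)%N].
Proof.
apply: (@sub_finite_set _ _ (@rVpoly F N @` setT)) => [P /= sP|].
  by exists (poly_rV P) => //; rewrite poly_rV_K.
exact/finite_image/finite_finset.
Qed.

(** An element of F[X, 1/X] with bounded poles at 0 and at infinity is a
    polynomial of bounded degree divided by a fixed power of X. *)
Lemma finite_bounded_laurent N : finite_set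
  [set x : laurent F | abs_zero R (val x) <= q ^+ N /\ abs_infty R (val x) <= q ^+ N].
Proof.
pose B : set (laurent F) := @laurent_val F @^-1`
  ((fun P : {poly F} => P%:F / 'X%:F ^+ N) @` [set P : {poly F} | (size P <= N + N.+1)%N]).
apply: (@sub_finite_set _ _ B).
  suff gen (f : K) : f \in @laurent_pred F ->
      abs_zero R f <= q ^+ N /\ abs_infty R f <= q ^+ N ->
      ((fun P : {poly F} => P%:F / 'X%:F ^+ N) @` [set P : {poly F} | (size P <= N + N.+1)%N]) f.
    by move=> x; apply: gen; exact: valP.
  move=> /laurentP[P [n ->]].
  have [->|P0] := eqVneq P 0.
    by move=> _; exists 0; [rewrite /= size_poly0 | rewrite tofrac0 !mul0r].
  have [m [P' [nP ->]]] := X_factor P0; rewrite tofracM tofracXn.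
  have Xn0 k : ('X : {poly F})%:F ^+ k != 0 by rewrite expf_neq0 ?tofracX_neq0.
  have := abs_zeroE R (m%:Z - n%:Z) nP (nX1 F); rewrite tofrac1 divr1.
  rewrite expfzDr ?tofracX_neq0// -exprnN -exprnP mulrAC => -> [].
  rewrite exprnP ler_eXz2l ?(q_gt1 R)// => mn.
  have eP : 'X%:F ^+ m * P'%:F / 'X%:F ^+ n = ('X ^+ (m + N - n) * P')%:F / ('X ^+ N)%:F.
    rewrite tofracM !tofracXn; apply/eqP; rewrite eqr_div// mulrAC -exprD.
    rewrite [X in _ == X]mulrAC -exprD; apply/eqP; congr (_ ^+ _ * _); lia.
  rewrite eP abs_inftyE; last 2 first.
  - by apply: mulf_neq0; [rewrite expf_neq0 ?polyX_eq0 | exact: X_ndvd0].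
  - by rewrite expf_neq0 ?polyX_eq0.
  rewrite ler_eXz2l ?(q_gt1 R)// size_polyXn => sz.
  exists ('X ^+ (m + N - n) * P'); last by rewrite tofracXn.
  by move: sz; rewrite lerBlDr -PoszD lez_nat.
apply: finite_preimage; first by move=> x y _ _; exact: val_inj.
exact/finite_image/finite_poly_size.
Qed.

Lemma finite_SL (E : set (laurent F)) : finite_set E ->
  finite_set [set g : G | forall i j, E (g i j)].
Proof.
move=> fE; pose f (g : G) := ((g 0 0, g 0 1), (g 1 0, g 1 1)).
apply: (@sub_finite_set _ _ (f @^-1` ((E `*` E) `*` (E `*` E)))).
  by move=> g h; rewrite /f; do !split => /=; apply: h.
apply: finite_preimage; last by do 2?apply: finite_setX.
move=> g g' _ _ [e1 e2 e3 e4]; apply/val_inj/matrixP.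
by elim/ord2P; elim/ord2P.
Qed.

Lemma SL_embM (a : K -> R) (Ka : completion a) (g h : G) :
  SL_emb Ka (g * h)%g = (SL_emb Ka g * SL_emb Ka h)%g.
Proof. by apply/val_inj; exact: map_mxM. Qed.

Section Length.
Variables (K0 : completion (@abs_zero R F)) (Kinf : completion (@abs_infty R F)).
Variables (v0 : tree K0) (vinf : tree Kinf).

Let pl0 := zero_place K0.
Let plinf := infty_place Kinf.
Local Notation ab0 := (@compl_abs _ _ _ K0).
Local Notation abinf := (@compl_abs _ _ _ Kinf).

Lemma finite_balls_SL n : finite_set [set g | (len (SL_emb K0) (SL_emb Kinf) v0 vinf g <= n)%N].
Proof.
have [t [u [_ r0]]] := rep_exists pl0 v0; have [t' [u' [_ rinf]]] := rep_exists plinf vinf.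
set h0 := hnf t u in r0; set hinf := hnf t' u' in rinf.
pose C0 := nm ab0 h0 * q ^+ n * nm ab0 (invmx h0).
pose Cinf := nm abinf hinf * q ^+ n * nm abinf (invmx hinf).
have [N hN] := q_cofinal (Num.max C0 Cinf).
have [h1 h2] : C0 <= q ^+ N /\ Cinf <= q ^+ N by move: hN; rewrite gt_max => /andP[/ltW ? /ltW].
apply: sub_finite_set (finite_SL (finite_bounded_laurent N)) => g /= gn i j.
have bound (a : K -> R) (Ka : completion a) (iota : F -> Ka) (pi : Ka)
    (pl : place (@compl_abs _ _ _ Ka) iota pi) (v : tree Ka) h : rep v h ->
    (disp (SL_emb Ka) v g <= n)%N ->
    a (val (g i j)) <= nm (@compl_abs _ _ _ Ka) h * q ^+ n * nm (@compl_abs _ _ _ Ka) (invmx h).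
  move=> rv dn; rewrite -(@compl_abs_emb _ _ _ Ka).
  have := nm_ge (@compl_abs _ _ _ Ka) (SL_emb Ka g) i j; rewrite mxE => /le_trans; apply.
  apply: le_trans (nm_le_disp pl (SL_emb Ka g) rv) _.
  rewrite ler_wpM2r ?nm_ge0// ler_wpM2l ?nm_ge0// ler_eXn2l ?(q_gt1 R)//.
split.
  apply: le_trans h1; apply: (bound _ _ _ _ pl0 _ _ r0).
  exact: leq_trans (leq_addr _ _) gn.
apply: le_trans h2; apply: (bound _ _ _ _ plinf _ _ rinf).
exact: leq_trans (leq_addl _ _) gn.
Qed.

Lemma laurent_polyV P n : P%:F / 'X%:F ^+ n \in @laurent_pred F.
Proof. by apply/laurentP; exists P, n. Qed.

Lemma laurent_poly P : P%:F \in @laurent_pred F.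
Proof. by have := laurent_polyV P 0; rewrite expr0 divr1. Qed.

Lemma laurent_Xz (k : int) : ('X : {poly F})%:F ^ k \in @laurent_pred F.
Proof.
case: k => n; first by rewrite -exprnP -tofracXn laurent_poly.
by rewrite NegzE -exprnN -[_^-1]mul1r -tofrac1 laurent_polyV.
Qed.

(** A truncated expansion in powers of [X] is a Laurent polynomial. *)
Lemma laurent_dense (u : K0) (r : R) : 0 < r ->
  exists2 f : K, f \in @laurent_pred F & ab0 (u - compl_emb K0 f) <= r.
Proof.
move=> r0; pose X : K0 := compl_emb K0 'X%:F.
have X0 : X != 0 by rewrite fmorph_eq0 tofracX_neq0.
have [m hm] := q_cofinal (ab0 u); have [N hN] := q_cofinal (q ^+ m / r).
have qp k : 0 < q ^+ k by rewrite exprn_gt0 ?(q_gt0 R).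
have : ab0 (u * X ^+ m) <= 1.
  by rewrite (abM pl0) (abpi pl0) ler_pdivrMr// mul1r ltW.
move=> /(digits_exist pl0 N)[c hc].
set P : {poly F} := \sum_(i < N) (tnth c i)%:P * 'X ^+ i.
have eP : \sum_(i < N) compl_emb K0 (const_frac F (tnth c i)) * X ^+ i = compl_emb K0 P%:F.
  rewrite /P !rmorph_sum; apply: eq_bigr => i _.
  by rewrite !rmorphM /= !rmorphXn.
exists (P%:F / 'X%:F ^+ m); first exact: laurent_polyV.
rewrite eP in hc; rewrite fmorph_div rmorphXn -/X.
have -> : u - compl_emb K0 P%:F / X ^+ m = (u * X ^+ m - compl_emb K0 P%:F) / X ^+ m.
  by rewrite mulrBl mulfK ?expf_neq0.
rewrite (abM pl0) (abV pl0) (abpi pl0) invrK.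
apply: le_trans (ler_wpM2r (ltW (qp m)) hc) _.
by rewrite mulrC ler_pdivrMr// mulrC -ler_pdivrMr// ltW.
Qed.

(** The centre of a ball can be moved to an element of a dense subring, and its
    radius is that of a power of [X]. So [v0] is the image of the standard vertex
    by an element of GL2(F[X, 1/X]). *)
Lemma rational_vertex : exists h : 'M[K]_2,
  [/\ h \in unitmx, h \is a mxOver (@laurent_pred F), invmx h \is a mxOver (@laurent_pred F) &
      rep v0 (map_mx (compl_emb K0) h)].
Proof.
have [t [u [t0 r0]]] := rep_exists pl0 v0.
have [n tn] := place_val pl0 t0.
have at0 : 0 < ab0 t by rewrite (ab_gt0 pl0).
have [f lf hf] := laurent_dense u at0.
have X0 : ('X : {poly F})%:F ^ (- n) != 0 by rewrite expfz_neq0 ?tofracX_neq0.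
have over t' u' : t' \in @laurent_pred F -> u' \in @laurent_pred F ->
    hnf t' u' \is a mxOver (@laurent_pred F).
  move=> lt lu; apply/mxOverP; elim/ord2P; elim/ord2P; rewrite mxE /= ?rpred0 ?rpred1//.
exists (hnf ('X%:F ^ (- n)) f); split.
- by rewrite hnf_unit.
- by apply: over => //; exact: laurent_Xz.
- rewrite hnfV// invr_expz opprK; apply: over; first exact: laurent_Xz.
  by rewrite rpredN rpredM// laurent_Xz.
have -> : map_mx (compl_emb K0) (hnf ('X%:F ^ (- n)) f) =
    hnf (compl_emb K0 ('X%:F ^ (- n))) (compl_emb K0 f).
  by apply/matrixP; elim/ord2P; elim/ord2P; rewrite !mxE /= ?rmorph0 ?rmorph1.
apply: (rep_ball pl0 t0 _ hf r0).
rewrite tn compl_abs_emb; have := abs_zeroE R (- n) (nX1 F) (nX1 F).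
by rewrite tofrac1 divr1 mulr1 opprK => ->.
Qed.

Lemma lift_SL (M : 'M[K]_2) : \det M = 1 -> M \is a mxOver (@laurent_pred F) ->
  exists g : G, map_mx \val g = M.
Proof.
move=> dM /mxOverP oM; pose A : 'M[laurent F]_2 := \matrix_(i, j) insubd 0 (M i j).
have eA : map_mx \val A = M by apply/matrixP => i j; rewrite !mxE insubdK ?oM.
have dA : \det A == 1.
  by apply/eqP/val_inj; rewrite -det_map_mx eA dM.
by exists (MkSL dA).
Qed.

Lemma abs_infty_poly_le (P : {poly F}) k : (size P <= k.+1)%N -> abs_infty R P%:F <= q ^+ k.
Proof.
have [->|P0] := eqVneq P 0.
  by rewrite tofrac0 /abs_infty eqxx exprn_ge0 ?(ltW (q_gt0 R F)).
rewrite abs_infty_poly// ler_eXn2l ?(q_gt1 R)//.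
by case: (size P).
Qed.

Lemma shift_nat (c : nat) (d : int) : (`|d| <= c)%N -> exists s : nat, s%:Z = c%:Z + d.
Proof. by move=> dc; exists (absz (c%:Z + d)%R); lia. Qed.

Lemma double_addn (x y : nat) (a b : int) : x%:Z = a + a -> y%:Z = b + b ->
  exists k, (x + y)%N = k.*2.
Proof. by move=> ea eb; exists (absz (a + b)%R); lia. Qed.

Lemma conj_eq0 (E : fieldType) (Z D Z' : 'M[E]_2) : Z' *m Z = 1%:M ->
  Z *m D *m Z' = 0 -> D = 0.
Proof.
move=> e h; have <- : Z' *m (Z *m D *m Z') *m Z = D.
  by rewrite !mulmxA e mul1mx -mulmxA e mulmx1.
by rewrite h mulmx0 mul0mx.
Qed.

Definition unipotent (p : {poly F}) : 'M[{poly F}]_2 :=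
  \matrix_(i, j) (if i == j then 1 else if i == 0 then p else 0).

Definition sandwich (p : {poly F}) (M : 'M[{poly F}]_2) :=
  unipotent p *m M *m (unipotent p)^T.

Lemma det_sandwich p M : \det M = 1 -> \det (sandwich p M) = 1.
Proof.
move=> dM; rewrite !det_mulmx det_tr dM.
by rewrite det2 !mxE /= mulr0 subr0 !mulr1.
Qed.

Lemma sandwichE p M : sandwich p M = \matrix_(i, j)
  (if i == 0 then (if j == 0 then M 0 0 + p * M 1 0 + (M 0 1 + p * M 1 1) * p
                   else M 0 1 + p * M 1 1)
   else (if j == 0 then M 1 0 + M 1 1 * p else M 1 1)).
Proof.
by apply/matrixP; elim/ord2P; elim/ord2P; rewrite !mulmx2E !mxE /=; ring.
Qed.

(** The entry [M 1 1] is multiplied by [X^(2C)] in the upper left corner, while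
    all other terms are multiplied by at most [X^C]. *)
Lemma sandwich_size (M : 'M[{poly F}]_2) m C : (forall i j, (size (M i j) <= m.+2)%N) ->
  forall i j,
    (size ((sandwich 'X^C M - ('X^C * 'X^C * M 1 1) *: delta_mx 0 0)%R i j) <= (m.+1 + C).+1)%N.
Proof.
move=> sM; have mul i j : (size ('X^C * M i j)%R <= (m.+1 + C).+1)%N.
  apply: leq_trans (size_polyMleq _ _) _; rewrite size_polyXn /=.
  by rewrite addnC -addSn leq_add2r.
have one i j : (size (M i j) <= (m.+1 + C).+1)%N.
  by apply: leq_trans (sM i j) _; rewrite ltnS leq_addr.
have add (a b : {poly F}) : (size a <= (m.+1 + C).+1 -> size b <= (m.+1 + C).+1 ->
    size (a + b)%R <= (m.+1 + C).+1)%N.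
  by move=> ha hb; apply: leq_trans (size_polyD _ _) _; rewrite geq_max ha hb.
rewrite sandwichE; elim/ord2P; elim/ord2P; rewrite !mxE /= ?mulr0 ?mulr1 ?subr0 //.
- rewrite (_ : _ - _ = M 0 0 + 'X^C * M 1 0 + 'X^C * M 0 1); last by ring.
  apply: (add _ _ (add _ _ (one 0 0) (mul 1 0)) (mul 0 1)).
- exact: (add _ _ (one 0 1) (mul 1 1)).
- rewrite [M 1 1 * _]mulrC; exact: (add _ _ (one 1 0) (mul 1 1)).
Qed.

(** Complete a coprime pair to a matrix [M] of determinant 1, with monic lower
    right entry of degree [m + 1], sandwich it, and conjugate by the matrix [hA]
    that sends the standard vertex to [v0]. The result fixes [v0]. At infinity, in
    a basis adapted to [vinf], it is the sum of a multiple of the fixed nonzero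
    matrix [Y] and of a term that is smaller when [C] is large; its norm, and so
    its length, depends on [m] only. *)
Lemma coprime_pairs_in_sphere : exists s : nat, forall m,
  (#|coprime_pairs F m.+1| <=
   #|` fset_set [set g | len (SL_emb K0) (SL_emb Kinf) v0 vinf g = (m.+1 + s).*2]|)%N.
Proof.
have [hA [uA oA oAV r0]] := rational_vertex.
have [t [u [t0 rinf]]] := rep_exists plinf vinf.
set h := hnf t u in rinf; have uh : h \in unitmx by rewrite hnf_unit.
pose B := map_mx (compl_emb Kinf) hA.
have uB : B \in unitmx by rewrite map_unitmx.
pose Z := invmx h *m B; pose Z' := invmx B *m h.
have ZZ' : Z *m Z' = 1%:M by rewrite mulmxA mulmxK// mulVmx.
have Z'Z : Z' *m Z = 1%:M by rewrite mulmxA mulmxK// mulVmx.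
pose Y := Z *m delta_mx 0 0 *m Z'.
have Y0 : Y != 0.
  apply/eqP => /(conj_eq0 Z'Z) /matrixP /(_ 0 0) /eqP.
  by rewrite !mxE oner_eq0.
have [d nY] := nm_pow plinf Y0.
have nY0 : 0 < nm abinf Y by apply: (nm_gt0 plinf).
(* [C1] makes the main term dominate; adding [`|d|] keeps [s] nonnegative *)
have [C1 hC1] := q_cofinal (nm abinf Z * nm abinf Z' / nm abinf Y).
pose C := (C1 + `|d|)%N.
have hC : nm abinf Z * nm abinf Z' < q ^+ C * nm abinf Y.
  rewrite -ltr_pdivrMr//; apply: lt_le_trans hC1 _.
  by rewrite ler_eXn2l ?(q_gt1 R)// leq_addr.
have [s es] : exists s : nat, s%:Z = (C + C)%:Z + d.
  by apply: shift_nat; rewrite /C addnACA addnC -addnA leq_addr.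
have qs : q ^+ (C + C) * nm abinf Y = q ^+ s.
  by rewrite nY !exprnP -expfzDr ?(q_neq0 R)// es.
exists s => m; set S := fset_set _.
have exponent : (((C.+1 + C.+1).-1 + m.+2).-2 = m.+1 + (C + C))%N.
  by move: {+}C => k; clear; lia.
have fS : finite_set [set g | len (SL_emb K0) (SL_emb Kinf) v0 vinf g = (m.+1 + s).*2].
  by apply: sub_finite_set (finite_balls_SL (m.+1 + s).*2) => g /= ->.
pose toK (M : 'M[{poly F}]_2) : 'M[K]_2 := map_mx (@FracField.tofrac {poly F}) M.
pose rel (p : 'rV[F]_m.+1 * 'rV[F]_m.+1) (g : G) := exists M : 'M[{poly F}]_2,
  [/\ map_mx \val g = hA *m toK (sandwich 'X^C M) *m invmx hA,
      M 1 1 = monic_of p.1 & M 1 0 = rVpoly p.2].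
have exg (p : 'rV[F]_m.+1 * 'rV[F]_m.+1) : exists g,
    p \in coprime_pairs F m.+1 -> g \in S /\ rel p g.
  have [|np] := boolP (p \in coprime_pairs F m.+1); last by exists 1%g.
  rewrite inE => cp.
  have [M [dM M10 M11 sM]] := bezout_sl2 (size_monic_of p.1) (size_rVpoly p.2) cp.
  set M' := sandwich 'X^C M; have dM' : \det M' = 1 by exact: det_sandwich.
  have oM' : toK M' \is a mxOver (@laurent_pred F).
    by apply/mxOverP => i j; rewrite mxE laurent_poly.
  have [||g eg] := @lift_SL (hA *m toK M' *m invmx hA).
  - by rewrite !det_mulmx det_map_mx dM' rmorph1 mulr1 -det_mulmx mulmxV// det1.
  - by rewrite !mxOverM.
  exists g => _; split; last by exists M.
  have emb (a : K -> R) (Ka : completion a) :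
      SL_mx (SL_emb Ka g) = map_mx (compl_emb Ka) hA *m map_mx (compl_emb Ka) (toK M') *m
        invmx (map_mx (compl_emb Ka) hA).
    by rewrite -map_invmx -!map_mxM -eg -map_mx_comp.
  apply/(in_fsetP _ fS) => /=; rewrite /len.
  (* in the basis [hA] the matrix is polynomial, hence integral at 0 *)
  have -> : disp (SL_emb K0) v0 g = 0%N.
    apply/eqP; rewrite -leqn0 -(ler_eXn2l (q_gt1 R F)) expr0 (act_disp pl0 _ r0) emb.
    have uA0 : map_mx (compl_emb K0) hA \in unitmx by rewrite map_unitmx.
    rewrite -!mulmxA mulVmx// mulmx1 mulKmx// expr_le1 ?nm_ge0//.
    by apply: nm_le => // i j; rewrite !mxE compl_abs_emb abs_zero_poly.
  rewrite add0n; apply/eqP; rewrite -(eq_exp_q R F) (act_disp plinf _ rinf) emb -/B.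
  set E := map_mx _ (toK M').
  have -> : invmx h *m (B *m E *m invmx B) *m h = Z *m E *m Z' by rewrite /Z /Z' !mulmxA.
  pose c : Kinf := compl_emb Kinf ('X^C * 'X^C * M 1 1)%:F.
  pose N := map_mx (compl_emb Kinf) (toK (M' - ('X^C * 'X^C * M 1 1) *: delta_mx 0 0)).
  have eE : E = c *: delta_mx 0 0 + N.
    apply/matrixP => i j; rewrite !mxE tofracB rmorphB addrC /c.
    by case: (_ && _); rewrite ?mulr1 ?mulr0 ?tofrac0 ?rmorph0 ?subrK.
  have ac : abinf c = q ^+ (m.+1 + (C + C)).
    have w0 : M 1 1 != 0 by rewrite M11 monic_neq0 ?monic_of_monic.
    have X0 : ('X^C : {poly F}) != 0 by rewrite expf_neq0 ?polyX_eq0.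
    rewrite compl_abs_emb abs_infty_poly ?mulf_neq0//.
    rewrite !size_mul ?mulf_neq0// !size_polyXn M11 size_monic_of.
    by rewrite exponent.
  have aN : nm abinf N <= q ^+ (m.+1 + C).
    apply: nm_le => [|i j]; first by rewrite exprn_ge0 ?(ltW (q_gt0 R F)).
    rewrite !mxE compl_abs_emb; apply: abs_infty_poly_le.
    by have := sandwich_size C sM i j; rewrite !mxE.
  rewrite eE mulmxDr mulmxDl -scalemxAr -scalemxAl -/Y.
  have nm_main : nm abinf (c *: Y) = q ^+ (m.+1 + s).
    by rewrite (nmZ plinf) ac exprD -mulrA qs -exprD.
  rewrite (nmD_dom plinf).
    by rewrite nm_main -exprM muln2.
  rewrite nm_main exprD -qs (exprD _ C C) 2!mulrA -exprD -mulrA.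
  have qm : 0 < q ^+ (m.+1 + C) by rewrite exprn_gt0 ?(q_gt0 R F).
  apply: (@le_lt_trans _ _ (nm abinf Z * q ^+ (m.+1 + C) * nm abinf Z')).
    by do 2!apply: (nmM_le plinf) => //.
  by rewrite mulrAC mulrC ltr_pM2l.
have [f hf] := choice exg.
have injf : {in coprime_pairs F m.+1 &, injective f}.
  move=> p p' cp cp' e; have [_ [M [eM M11 M10]]] := hf p cp.
  have [_ [M' [eM' M11' M10']]] := hf p' cp'.
  have : toK (sandwich 'X^C M) = toK (sandwich 'X^C M').
    apply: (can_inj (mulKmx uA)); apply: (can_inj (mulmxKV uA)).
    by rewrite -eM -eM' e.
  move=> eS; have eij i j : sandwich 'X^C M i j = sandwich 'X^C M' i j.
    by apply/eqP; rewrite -tofrac_eq; have /matrixP/(_ i j) := eS; rewrite !mxE => ->.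
  have e11 : M 1 1 = M' 1 1 by have := eij 1 1; rewrite !sandwichE !mxE.
  have e10 : M 1 0 = M' 1 0.
    by have := eij 1 0; rewrite !sandwichE !mxE /= e11 => /addIr.
  move: e11 e10; rewrite M11 M11' M10 M10'.
  case: p p' {cp cp' e eM eM' M11 M11' M10 M10'} => [a b] [a' b'] /=.
  by move=> /addrI /rVpoly_inj -> /rVpoly_inj ->.
rewrite cardE -(size_map f); apply: uniq_leq_size.
  by rewrite map_inj_in_uniq ?enum_uniq// => p p'; rewrite !mem_enum; exact: injf.
by move=> _ /mapP[p + ->]; rewrite mem_enum => /hf[].
Qed.

(** A nonempty sphere has even radius, since displacements are even. The spheres
    of radius at most 2 s are covered by adjusting the constant. *)
Lemma sphere_growth : exists2 c : R, 0 < c & forall n h,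
  len (SL_emb K0) (SL_emb Kinf) v0 vinf h = n ->
  q ^+ n <= c * #|` fset_set [set g | len (SL_emb K0) (SL_emb Kinf) v0 vinf g = n]|%:R.
Proof.
have [s hs] := coprime_pairs_in_sphere; have q0 k : 0 < q ^+ k by rewrite exprn_gt0 ?(q_gt0 R F).
exists (2 * q ^+ s.*2); first by rewrite mulr_gt0.
move=> n h hn; set S := fset_set _.
have fS : finite_set [set g | len (SL_emb K0) (SL_emb Kinf) v0 vinf g = n].
  by apply: sub_finite_set (finite_balls_SL n) => g /= ->.
have S1 : (1 <= #|` S|)%N.
  by rewrite cardfs_gt0; apply/fset0Pn; exists h; exact/(in_fsetP _ fS).
have [k nk] : exists k, n = k.*2.
  have even (Ka : fieldType) (ab : Ka -> R) (iota : F -> Ka) (pi : Ka)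
      (pl : place ab iota pi) (g : SL 2 Ka) (v : vertex ab) :
      exists a : int, (tree_dist v (act g v))%:Z = a + a.
    have [t [u [t0 rv]]] := rep_exists pl v.
    have [a ea] := nm_conj_pow pl g (proj1 rv).
    exists a; apply: (ieexprIz (q_gt0 R F)); first by rewrite gt_eqF ?(q_gt1 R).
    by rewrite -exprnP (act_disp pl g rv) ea expr2 -expfzDr ?(q_neq0 R).
  have [a ea] := even _ _ _ _ pl0 (SL_emb K0 h) v0.
  have [b eb] := even _ _ _ _ plinf (SL_emb Kinf h) vinf.
  by rewrite -hn; exact: double_addn ea eb.
have q1 m m' : (m <= m')%N -> q ^+ m <= q ^+ m' by rewrite ler_eXn2l ?(q_gt1 R).
have [ks|sk] := leqP k s.
  apply: (@le_trans _ _ (2 * q ^+ s.*2)).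
    apply: (@le_trans _ _ (q ^+ s.*2)); first by rewrite nk q1 ?leq_double.
    by rewrite ler_peMl ?ltW// ltr1n.
  by rewrite ler_peMr ?ler1n// mulr_ge0 ?ltW.
have [m em] : exists m, k = (m.+1 + s)%N by exists (k - s).-1; lia.
have le : (#|F| ^ (m.+1 + m.+1) <= 2 * #|` S|)%N.
  apply: leq_trans (card_coprime_pairs F m) _; rewrite leq_mul2l /S nk em.
  exact: hs.
rewrite nk em -addnn addnACA exprD !addnn -(ler_nat R) natrX natrM in le *.
by rewrite [leRHS]mulrAC (ler_wpM2r (ltW (q0 _))).
Qed.

End Length.
End LaurentGroup.

Theorem corollary1 (R : realType) (F : finFieldType)
    (K0 : completion (@abs_zero R F)) (Kinf : completion (@abs_infty R F))
    (v0 : tree K0) (vinf : tree Kinf) :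
  RRD (tree_length v0 vinf).
Proof.
have [c c0 hc] := sphere_growth v0 vinf.
exact: (RRD_of_growth (zero_place K0) (infty_place Kinf) (SL_embM K0) (SL_embM Kinf)
  (@finite_balls_SL _ _ _ _ v0 vinf) c0 hc).
Qed.
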